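(* Let $X$ be a Banach space. The following statements are equivalent: (a) $X$ is reflexive. (b) $\mathrm{NA}(X,Y)=\mathrm{QNA}(X,Y)$ for every Banach space $Y$. (c) There exists a nontrivial Banach space $Y$ (i.e. $Y\neq\{0\}$) such that $\mathrm{NA}(X,Y)=\mathrm{QNA}(X,Y)$.
   Context: Banach spaces are over $\mathbb{K}=\mathbb{R}$ or $\mathbb{C}$; $B_X$ is the closed unit ball of $X$. For a bounded linear operator $T\colon X\to Y$: $T\in\mathrm{NA}(X,Y)$ (norm attaining) if there is $x_0\in B_X$ with $\|Tx_0\|=\|T\|$; $T\in\mathrm{QNA}(X,Y)$ (quasi norm attaining) if there is $u\in\overline{T(B_X)}$ (norm closure) with $\|u\|=\|T\|$. *)

(* Defs.v *)
From HB Require Import structures.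
From mathcomp Require Import all_boot all_order all_algebra.
From mathcomp Require Import all_classical all_reals all_analysis.
From mathcomp Require Export complex.

Set Implicit Arguments.
Unset Strict Implicit.
Unset Printing Implicit Defensive.

Import Order.TTheory GRing.Theory Num.Theory.
Import numFieldNormedType.Exports.

Local Open Scope classical_set_scope.
Local Open Scope ring_scope.

Section Operators.
Context {K : numFieldType}.

Definition unit_ball (X : normedModType K) : set X := [set x | `|x| <= 1].
Arguments unit_ball : clear implicits.

Definition bounded_op (X Y : normedModType K) (T : X -> Y) : Prop :=
  exists M : K, forall x, `|T x| <= M * `|x|.

(* The norm of a module over K takes its values in K, so the operator norm is a
   least upper bound for the (partial) order of K.  For K = R[i], an upper bound
   of a nonempty set of nonnegative reals is itself real, hence this is the
   usual supremum in R. *)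
Definition opnorm (X Y : normedModType K) (T : X -> Y) : K :=
  supremum 0 [set `|T x| | x in unit_ball X].

Definition NA (X Y : normedModType K) : set {linear X -> Y} :=
  [set T : {linear X -> Y} | bounded_op T /\
    exists2 x0 : X, unit_ball X x0 & `|T x0| = opnorm T].

Definition QNA (X Y : normedModType K) : set {linear X -> Y} :=
  [set T : {linear X -> Y} | bounded_op T /\
    exists2 u : Y, closure (T @` unit_ball X) u & `|u| = opnorm T].

End Operators.

Arguments unit_ball {K} X _.
Arguments NA {K} X Y _.
Arguments QNA {K} X Y _.

Section Dual.
Context {K : numFieldType} (X : normedModType K).

Definition dual_pred : {pred X -> K^o} :=
  [pred f | `[< linear (f : X -> K^o) /\ bounded_op (f : X -> K^o) >]].

Lemma dual_pred_submod : submod_closed dual_pred.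
Proof.
split=> [|a f g /asboolP[lf [M fM]] /asboolP[lg [N gN]]]; apply/asboolP; split.
- by move=> c x y /=; rewrite [RHS]addr0 [RHS]mulr0.
- by exists 0 => x; rewrite normr0 mul0r.
- move=> c x y; rewrite -![(a *: f + g) _]/(a *: f _ + g _) lf lg.
  by rewrite !scalerDr !scalerA (mulrC a c) addrACA.
- exists (`|a| * M + N) => x.
  rewrite -[(a *: f + g) x]/(a *: f x + g x) mulrDl -mulrA.
  by rewrite (le_trans (ler_normD _ _))// lerD// normrZ ler_wpM2l.
Qed.

HB.instance Definition _ := GRing.isSubmodClosed.Build K (X -> K^o) dual_pred
  dual_pred_submod.

Record dual : Type := Dual {
  dual_fun :> X -> K^o;
  dual_funP : dual_fun \in dual_pred
}.

HB.instance Definition _ := [isSub for dual_fun].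
HB.instance Definition _ := [Choice of dual by <:].
HB.instance Definition _ := [SubChoice_isSubLmodule of dual by <:].

(* [dual] carries no topology here: boundedness of a functional on it, i.e.
   membership in the bidual, refers explicitly to the dual norm [opnorm]. *)
Definition bidual : set {linear dual -> K^o} :=
  [set phi : {linear dual -> K^o} |
    exists M : K, forall f : dual, `|phi f| <= M * opnorm f].

Definition canonical_embedding (x : X) : dual -> K^o := fun f => f x.

Definition reflexive_space : Prop :=
  forall phi, bidual phi -> exists x : X, canonical_embedding x = phi.

End Dual.

(* Main.v *)
Require Import Defs.
From HB Require Import structures.
From mathcomp Require Import all_boot all_order all_algebra.
From mathcomp Require Import all_classical all_reals all_analysis.
From mathcomp Require Import ring lra.

(* The implication from (c) to (a) is James' theorem: if [NA X Y = QNA X Y] and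
   [y] is a nonzero vector of [Y], then every functional [f] attains its norm,
   because the rank-one operator [f (.) y] quasi attains its norm.

   James' theorem is proved for a real vector space with a complete seminorm.
   If [Phi] in the bidual is at distance [d > 0] from [X], Helly's theorem
   gives functionals [f n] and vectors [x n] in the unit balls with
   [f i (x n) >= d / 2] for [i <= n] and [|f i (x n)| <= d / 4] for [i > n],
   so that every convex combination of the [f n] stays at distance [d / 4] from
   every limit [w] of their convex blocks. Thinning out the sequence makes
   [nu u := |u - w|] independent of [w] for every rational combination [u] of
   the [f n]. Then, as in Simons' inequality, blocks [g n] are chosen such that
   [u := \sum_n (D ^ n - D ^ n.+1) g n] nearly minimises [nu] at every stage; if
   [u - w] attained its norm at [x], where [w] is a limit of the [g n], then
   [g n x - w x] would be bounded below by a positive constant for all [n].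

   From (a) to (b), an ultrafilter of points of the ball whose images converge
   to [u] defines an element of the bidual; the point representing it is mapped
   to [u].

   A complex space is viewed as a real one by restriction of scalars; a complex
   functional is determined by its real part. *)

Set Implicit Arguments.
Unset Strict Implicit.
Unset Printing Implicit Defensive.

Import Order.TTheory GRing.Theory Num.Theory.
Import numFieldNormedType.Exports.

Local Open Scope classical_set_scope.
Local Open Scope ring_scope.

(** * Minimal sublinear functionals and the Hahn-Banach theorem *)

Section HahnBanach.
Context {R : realType} {V : lmodType R}.
Implicit Types (p q : V -> R) (x y : V).

Definition sublinear p :=
  (forall x y, p (x + y) <= p x + p y) /\
  (forall t x, 0 <= t -> p (t *: x) <= t * p x).

Lemma sublinear0 p : sublinear p -> p 0 = 0.
Proof.
move=> [pD pZ]; have := pZ 0 0 (lexx 0); have := pD 0 0.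
rewrite scale0r addr0 mul0r; lra.
Qed.

Lemma sublinearN p x : sublinear p -> - p (- x) <= p x.
Proof.
move=> psub; have p0 := sublinear0 psub; case: psub => pD _.
by have := pD x (- x); rewrite subrr p0; lra.
Qed.

Lemma sublinearZ p t x : sublinear p -> 0 <= t -> p (t *: x) = t * p x.
Proof.
move=> psub; rewrite le_eqVlt => /predU1P[<-|t0].
  by rewrite scale0r mul0r sublinear0.
case: psub => _ pZ; apply/eqP; rewrite eq_le (pZ _ _ (ltW t0))/=.
have := pZ t^-1 (t *: x); rewrite invr_ge0 ltW// scalerA mulVf ?gt_eqF// scale1r.
by move=> /(_ isT); rewrite ler_pdivlMl.
Qed.

(** The infimum of this set, as a function of [x], is the largest sublinear functional below [q]
    whose value at [- y] is at most [- q y]. *)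
Let tilt q y x := [set q (x + t *: y) - t * q y | t in [set t | 0 <= t]].

Let tilt_lb q y x : sublinear q -> lbound (tilt q y x) (- q (- x)).
Proof.
move=> qsub _ [t /= t0 <-].
have [qD _] := qsub; have := qD (x + t *: y) (- x).
rewrite addrAC subrr add0r (sublinearZ _ qsub t0); lra.
Qed.

Let tilt_inf q y x : sublinear q -> has_inf (tilt q y x).
Proof.
move=> qsub; split; last by exists (- q (- x)); exact: tilt_lb.
by exists (q (x + 0 *: y) - 0 * q y); exists 0 => //=.
Qed.

Let tilt_le q y x t : sublinear q -> 0 <= t ->
  inf (tilt q y x) <= q (x + t *: y) - t * q y.
Proof. by move=> qs t0; apply: ge_inf; [case: (tilt_inf y x qs)|exists t]. Qed.

(* Hence a minimal sublinear functional is superadditive, so linear. *)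
Lemma sublinear_tilt q y : sublinear q ->
  exists2 r, sublinear r & forall x, r x <= q x /\ r x <= q (x + y) - q y.
Proof.
move=> qsub; exists (fun x => inf (tilt q y x)); last first.
  move=> x; split.
    by have := tilt_le y x qsub (lexx 0); rewrite scale0r addr0 mul0r subr0.
  by have := tilt_le y x qsub ler01; rewrite scale1r mul1r.
split=> [x x'|a x].
  rewrite -lerBlDr; apply: lb_le_inf; first by case: (tilt_inf y x qsub).
  move=> _ [t /= t0 <-]; rewrite lerBlDr -lerBlDl.
  apply: lb_le_inf; first by case: (tilt_inf y x' qsub).
  move=> _ [s /= s0 <-]; rewrite lerBlDl.
  apply: le_trans (tilt_le y _ qsub (addr_ge0 t0 s0)) _.
  have [qD _] := qsub; have := qD (x + t *: y) (x' + s *: y).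
  rewrite scalerDl addrACA; lra.
rewrite le_eqVlt => /predU1P[<-|a0].
  rewrite scale0r mul0r (le_trans (tilt_le _ _ qsub (lexx 0)))//.
  by rewrite scale0r mul0r addr0 sublinear0// subr0.
rewrite mulrC -ler_pdivrMr//; apply: lb_le_inf; first by case: (tilt_inf y x qsub).
move=> _ [t /= t0 <-]; rewrite ler_pdivrMr//.
have at0 : 0 <= a * t by rewrite mulr_ge0// ltW.
rewrite (le_trans (tilt_le _ _ qsub at0))//.
by rewrite -scalerA -scalerDr (sublinearZ _ qsub (ltW a0)); lra.
Qed.

(** Zorn's lemma for the reversed pointwise order gives a minimal sublinear [q] below [p]. The tilt
    of [q] at [y] cannot be strictly smaller, so [q x <= q (x + y) - q y]. *)
Lemma hahn_banach p : sublinear p ->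
  exists2 f : V -> R, scalar f & forall x, f x <= p x.
Proof.
move=> psub.
pose T := {q : V -> R | sublinear q /\ forall x, q x <= p x}.
pose le (s t : T) := `[< forall x, sval t x <= sval s x >].
have p0 : sublinear p /\ forall x, p x <= p x by split.
have [||A totA|[q [qsub qp]] qmin] := @ZL_preorder T (exist _ p p0) le.
- by move=> t; apply/asboolP.
- move=> r s t /asboolP rs /asboolP st; apply/asboolP => x.
  exact: le_trans (st x) (rs x).
- have [[s0 As0]|A0] := pselect (A !=set0); last first.
    by exists (exist _ p p0) => s As; case: A0; exists s.
  pose E x := [set sval s x | s in A].
  have Einf x : has_inf (E x).
    split; first by exists (sval s0 x); exists s0.
    exists (- p (- x)) => _ [s As <-].
    have [ssub sp] := svalP s.
    by rewrite (le_trans _ (sublinearN _ ssub))// lerN2.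
  have Ele s x : A s -> inf (E x) <= sval s x.
    by move=> As; apply: ge_inf; [case: (Einf x)|exists s].
  have Esub : sublinear (fun x => inf (E x)) /\ forall x, inf (E x) <= p x.
    split; last first.
      by move=> x; have [_ /(_ x)] := svalP s0; apply: le_trans; exact: Ele.
    split=> [x y|t x].
      rewrite -lerBlDr; apply: lb_le_inf; first by case: (Einf x).
      move=> _ [s As <-]; rewrite lerBlDr -lerBlDl.
      apply: lb_le_inf; first by case: (Einf y).
      move=> _ [s' As' <-]; rewrite lerBlDl.
      (* Subadditivity of the infimum of a chain: the smaller of the two members serves both [x] and
         [y]. *)
      have [/asboolP ss'|/asboolP ss'] := totA _ _ As As'.
        rewrite (le_trans (Ele _ _ As'))//; have [[+ _] _] := svalP s'.
        by move=> /(_ x y); have := ss' x; lra.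
      rewrite (le_trans (Ele _ _ As))//; have [[+ _] _] := svalP s.
      by move=> /(_ x y); have := ss' y; lra.
    rewrite le_eqVlt => /predU1P[<-|t0].
      rewrite scale0r mul0r (le_trans (Ele _ _ As0))//.
      by rewrite sublinear0//; have [] := svalP s0.
    rewrite mulrC -ler_pdivrMr//; apply: lb_le_inf; first by case: (Einf x).
    move=> _ [s As <-]; rewrite ler_pdivrMr// (le_trans (Ele _ _ As))//.
    by rewrite sublinearZ ?(ltW t0)// 1?mulrC//; have [] := svalP s.
  by exists (exist _ (fun x => inf (E x)) Esub) => s As; apply/asboolP => x; exact: Ele.
have qD x y : q (x + y) = q x + q y.
  have [qD _] := qsub; apply/eqP; rewrite eq_le qD/=.
  have [r rsub rq] := sublinear_tilt y qsub.
  have rP : sublinear r /\ forall x, r x <= p x.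
    by split=> // z; apply: le_trans (qp z); case: (rq z).
  have /asboolP/(_ x)/= qr : le (exist _ r rP) (exist _ q (conj qsub qp)).
    by apply: qmin; apply/asboolP => z /=; case: (rq z).
  by have [_] := rq x; lra.
have qN x : q (- x) = - q x.
  by have := qD x (- x); rewrite subrr (sublinear0 qsub); lra.
exists q => // a x y; rewrite qD; congr (_ + _).
have [a0|a0] := leP 0 a; first exact: sublinearZ.
rewrite -[a in LHS]opprK scaleNr qN sublinearZ ?oppr_ge0 ?(ltW a0)//.
by rewrite mulNr opprK.
Qed.

(** A linear functional below the tilt of [p] at [x0] has value at most [- p x0] at [- x0], hence at
    least [p x0] at [x0]. *)
Lemma hahn_banach_at p x0 : sublinear p ->
  exists2 f : V -> R, scalar f & f x0 = p x0 /\ forall x, f x <= p x.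
Proof.
move=> psub; have [r rsub rp] := sublinear_tilt x0 psub.
have [f flin fr] := hahn_banach rsub; exists f => //.
have fp x : f x <= p x by apply: le_trans (fr x) _; case: (rp x).
split=> //; apply/eqP; rewrite eq_le fp/=.
have f0 : f 0 = 0.
  by have := flin 1 0 0; rewrite scale1r addr0 mul1r; lra.
have fN : f (- x0) = - f x0.
  by have := flin (-1) x0 0; rewrite scaleN1r !addr0 f0; lra.
have [_] := rp (- x0); rewrite addNr (sublinear0 psub).
by have := fr (- x0); rewrite fN; lra.
Qed.

End HahnBanach.

(** * Helly's theorem *)

(** Dependent choice with full history. The values chosen so far are kept in the list [s n]; since
    [P n] only looks below [n], the default [t0] of [nth] is harmless. *)
Lemma history_choice (T : Type) (t0 : T) (P : nat -> (nat -> T) -> T -> Prop) :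
  (forall n u v t, (forall k, (k < n)%N -> u k = v k) -> P n u t -> P n v t) ->
  (forall n u, (forall k, (k < n)%N -> P k u (u k)) -> exists t, P n u t) ->
  exists u, forall n, P n u (u n).
Proof.
move=> Pext Pex.
have /choice[F FP] : forall nu : nat * (nat -> T), exists t,
    (forall k, (k < nu.1)%N -> P k nu.2 (nu.2 k)) -> P nu.1 nu.2 t.
  move=> [n u] /=; have [/Pex[t Pt]|nP] :=
    pselect (forall k, (k < n)%N -> P k u (u k)); first by exists t.
  by exists t0.
pose s := fix s n :=
  if n is m.+1 then rcons (s m) (F (m, nth t0 (s m))) else [::].
have size_s n : size (s n) = n by elim: n => //= n IH; rewrite size_rcons IH.
pose u n := nth t0 (s n.+1) n.
have sE n k : (k < n)%N -> nth t0 (s n) k = u k.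
  elim: n => // n IH; rewrite ltnS leq_eqVlt => /predU1P[->//|kn].
  by rewrite /= nth_rcons size_s kn IH.
exists u; elim/ltn_ind => n IH.
have -> : u n = F (n, nth t0 (s n)) by rewrite /u /= nth_rcons size_s ltnn eqxx.
apply: (Pext _ (nth t0 (s n))); first exact: sE.
apply: (FP (n, nth t0 (s n))) => k kn /=; rewrite sE//.
by apply: Pext (IH k kn) => j jk; rewrite sE// (ltn_trans jk).
Qed.

(* If [c] were at distance [sqrt m > 0], moving from a near-minimiser [x] of
   the squared distance towards a point [y] almost maximising the form
   [c - x] would bring the distance below [sqrt m]. *)
Lemma helly (R : realType) (n : nat) (C : set ('I_n -> R)) (c : 'I_n -> R)
    (M : R) :
  C !=set0 ->
  (forall a b t, C a -> C b -> 0 <= t <= 1 ->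
    C (fun i => a i + t * (b i - a i))) ->
  (forall b i, C b -> `|b i| <= M) ->
  (forall l e, 0 < e -> exists2 b, C b &
    \sum_i l i * c i <= \sum_i l i * b i + e) ->
  forall e, 0 < e -> exists2 b, C b & forall i, `|b i - c i| <= e.
Proof.
move=> [b0 Cb0] Cconv CM Cl e e0.
pose Q (b : 'I_n -> R) := \sum_i (b i - c i) ^+ 2.
have Q0 b : 0 <= Q b by apply: sumr_ge0 => i _; exact: sqr_ge0.
pose E := [set Q b | b in C]; pose m := inf E.
have Einf : has_inf E.
  by split; [exists (Q b0); exists b0|exists 0 => _ [b _ <-]].
have mQ b : C b -> m <= Q b by move=> Cb; apply: ge_inf; [case: Einf|exists b].
have [me|em] := ltP m (e ^+ 2).
  have me0 : 0 < e ^+ 2 - m by rewrite subr_gt0.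
  have [_ [b Cb <-]] := inf_adherent me0 Einf.
  rewrite -/m [m + _]addrC subrK => Qb; exists b => // i.
  rewrite -(@ler_pXn2r _ 2)// ?nnegrE ?(ltW e0)// -normrX ger0_norm ?sqr_ge0//.
  apply: le_trans (ltW Qb); rewrite /Q (bigD1 i)//= lerDl.
  by apply: sumr_ge0 => j _; exact: sqr_ge0.
have m0 : 0 < m by apply: lt_le_trans em; rewrite exprn_gt0.
pose K := 1 + \sum_(i < n) (M + M) ^+ 2.
have K0 : 0 < K by rewrite ltr_pwDl// sumr_ge0// => i _; exact: sqr_ge0.
(* Moving from [x] to [x + t * (y - x)] changes the squared distance by [- 2 * t * S + t ^+ 2 * D].
   With [3 * m / 4 <= S], [D <= K] and [t * (K + m) = m / 2] this is at most [- t * m], while [Q x]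
   exceeds [m] by less than [t * m / 2]. *)
pose t := m / (2 * (K + m)).
have Km0 : 0 < K + m by rewrite addr_gt0.
have t0 : 0 < t by rewrite divr_gt0// mulr_gt0.
have tKm : t * (K + m) = m / 2 by rewrite /t; field; rewrite gt_eqF.
have t1 : t <= 1.
  by rewrite /t ler_pdivrMr ?mulr_gt0//; lra.
have tm0 : 0 < t * m / 2 by exact: divr_gt0 (mulr_gt0 t0 m0) (ltr0Sn _ _).
have [_ [x Cx <-]] := inf_adherent tm0 Einf; rewrite -/m => Qx.
have [y Cy] := Cl (fun i => c i - x i) (m / 4) (divr_gt0 m0 (ltr0Sn _ _)).
pose S := \sum_i (c i - x i) * (y i - x i).
pose D := \sum_i (y i - x i) ^+ 2.
have -> : \sum_i (c i - x i) * c i = Q x + \sum_i (c i - x i) * x i.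
  by rewrite -big_split/=; apply: eq_bigr => i _; ring.
have -> : \sum_i (c i - x i) * y i = S + \sum_i (c i - x i) * x i.
  by rewrite -big_split/=; apply: eq_bigr => i _; ring.
move=> QS.
have DK : D <= K.
  rewrite /K ler_wpDl// ler_sum// => i _.
  rewrite -[leLHS]ger0_norm ?sqr_ge0// normrX lerXn2r ?nnegrE//.
    by rewrite addr_ge0// (le_trans (normr_ge0 _) (CM x i Cx)).
  by rewrite (le_trans (ler_normB _ _))// lerD// CM.
have /mQ : C (fun i => x i + t * (y i - x i)).
  by apply: Cconv; rewrite // (ltW t0) t1.
have -> : Q (fun i => x i + t * (y i - x i)) = Q x - 2 * t * S + t ^+ 2 * D.
  rewrite /Q /S /D !mulr_sumr -sumrB -big_split/=.
  by apply: eq_bigr => i _; ring.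
have tS : t * (Q x + \sum_i (c i - x i) * x i) <=
    t * (S + \sum_i (c i - x i) * x i + m / 4) by rewrite ler_pM2l.
have tD : t * (t * D) <= t * (t * (K + m)).
  by rewrite !ler_pM2l//; lra.
have tQ : t * m <= t * Q x by rewrite ler_pM2l// mQ.
rewrite tKm in tD; have : 0 < t * m by rewrite mulr_gt0.
rewrite expr2; lra.
Qed.

(** * Selection of convex blocks *)

Section BlockSelection.
Context {R : realType} {F : nzRingType} {E : lmodType F}.
Variables (D : F) (C : nat -> set E) (nu : E -> R) (eps : nat -> R).
Implicit Types (a b : E) (g : nat -> E).

(** The weights sum to [1 - D ^+ n]. In [block] the last vector takes the remaining mass [D ^+ n],
    so for [0 <= D <= 1] a block is a convex combination. *)
Definition partial_block g n := \sum_(j < n) (D ^+ j - D ^+ j.+1) *: g j.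

Definition block g n := partial_block g n + D ^+ n *: g n.

Lemma partial_blockS g n :
  partial_block g n.+1 = partial_block g n + (D ^+ n - D ^+ n.+1) *: g n.
Proof. by rewrite /partial_block big_ord_recr. Qed.

(** A completion at stage [n.+1] is also a completion at stage [n], by a convex combination of [g n]
    and [b]. *)
Lemma partial_block_merge g n b :
  partial_block g n.+1 + D ^+ n.+1 *: b =
  partial_block g n + D ^+ n *: ((1 - D) *: g n + D *: b).
Proof.
by rewrite partial_blockS scalerDr !scalerA mulrBr mulr1 -exprSr addrA.
Qed.

Hypothesis C0 : forall n, C n !=set0.
Hypothesis CS : forall n, C n.+1 `<=` C n.
Hypothesis CD : forall n a b, C n a -> C n b -> C n ((1 - D) *: a + D *: b).
Hypothesis eps0 : forall n, 0 < eps n.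
Variables (lo hi : R).
Hypothesis nuC : forall a, C 0%N a -> lo <= nu a <= hi.

Let partial_blockC g n a : (forall k, (k < n)%N -> C k (g k)) -> C n a ->
  C 0%N (partial_block g n + D ^+ n *: a).
Proof.
elim: n a => [|n IH] a gC Ca.
  by rewrite /partial_block big_ord0 add0r expr0 scale1r.
rewrite partial_block_merge; apply: IH => [k kn|]; first by apply: gC; exact: ltnW.
by apply: CD; [exact: gC|exact: CS].
Qed.

Let values g n := [set nu (partial_block g n + D ^+ n *: a) | a in C n].

(** Each [g n] minimises [nu], up to [eps n], among the completions of the partial block by vectors
    of [C n]. By [partial_block_merge] the infima [A n] increase with [n]; they are bounded by [hi],
    and [al] is their limit. *)
Lemma block_selection : exists g (al : R),
  [/\ forall n, C n (g n), forall n, C 0%N (block g n), lo <= al,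
      forall n, nu (block g n) <= al + eps n &
      forall e, 0 < e -> exists n0, forall n, (n0 <= n)%N ->
        al - e < nu (block g n)].
Proof.
have val_inf g n : (forall k, (k < n)%N -> C k (g k)) -> has_inf (values g n).
  move=> gC; split.
    by have [a Ca] := C0 n; exists (nu (partial_block g n + D ^+ n *: a)); exists a.
  exists lo => _ [a Ca <-].
  by have /andP[] := nuC (partial_blockC gC Ca).
have [a0 _] := C0 0%N.
pose P n g a := C n a /\
  nu (partial_block g n + D ^+ n *: a) < inf (values g n) + eps n.
have [||g gP] := @history_choice E a0 P.
- move=> n g h a gh; rewrite /P /values.
  suff -> : partial_block h n = partial_block g n by [].
  by apply: eq_bigr => i _; rewrite gh.
- move=> n g gP; have gC k : (k < n)%N -> C k (g k) by move=> /gP[].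
  by have [_ [a Ca <-] alt] := inf_adherent (eps0 n) (val_inf g n gC); exists a.
have gC n : C n (g n) by case: (gP n).
have blockC n : C 0%N (block g n) by exact: partial_blockC.
pose A n := inf (values g n).
have Alo n : A n <= nu (block g n).
  by apply: ge_inf; [case: (val_inf g n (fun k _ => gC k))|exists (g n)].
have loA n : lo <= A n.
  apply: lb_le_inf; first by case: (val_inf g n (fun k _ => gC k)).
  move=> _ [a Ca <-].
  by have /andP[] := nuC (partial_blockC (fun k _ => gC k) Ca).
have Amono : {homo A : m n / (m <= n)%N >-> m <= n}.
  apply: homo_leq => [//|? ? ?|n]; first exact: le_trans.
  apply: lb_le_inf; first by case: (val_inf g n.+1 (fun k _ => gC k)).
  move=> _ [b Cb <-]; rewrite partial_block_merge.
  apply: ge_inf; first by case: (val_inf g n (fun k _ => gC k)).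
  by exists ((1 - D) *: g n + D *: b) => //; apply: CD => //; exact: CS.
have Asup : has_sup (range A).
  split; first by exists (A 0%N); exists 0%N.
  exists hi => _ [n _ <-]; apply: le_trans (Alo n) _.
  by have /andP[] := nuC (blockC n).
exists g, (sup (range A)); split=> // [|n|e e0].
- by apply: le_trans (loA 0%N) _; apply: sup_upper_bound => //; exists 0%N.
- have [_ /ltW/le_trans->//] := gP n; rewrite lerD2r.
  by apply: sup_upper_bound => //; exists n.
- have [_ [n0 _ <-] An0] := sup_adherent e0 Asup.
  exists n0 => n /Amono An; apply: lt_le_trans An0 _.
  exact: le_trans An (Alo n).
Qed.

End BlockSelection.

(** * Thinning out a sequence of functions *)

Section Stabilisation.
Context {R : realType} {T : Type}.
Variables (B : set T) (f : nat -> T -> R) (M : R).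
Hypothesis B0 : B !=set0.
Hypothesis fM : forall k y, B y -> `|f k y| <= M.

Let unbounded (A : set nat) := forall n, exists2 k, (n <= k)%N & A k.

(** Here [s] is the supremum over [y] in [B] of the upper limit of [u y - f k y] along [A]. A nearly
    optimal [x] stays above [s - e] at infinitely many [k], and these form [A']. *)
Let stabilize_step (A : set nat) (u : T -> R) (M' e : R) :
  unbounded A -> (forall y, B y -> `|u y| <= M') -> 0 < e ->
  exists A' : set nat, [/\ A' `<=` A, unbounded A' & exists s,
    (forall y d, B y -> 0 < d -> exists n, forall k, (n <= k)%N -> A k ->
      u y - f k y < s + d) /\
    (exists2 x, B x & forall k, A' k -> s - e < u x - f k x)].
Proof.
move=> Aoo uM' e0.
pose S := [set t | exists2 y, B y & unbounded [set k | A k /\ t <= u y - f k y]].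
have Ssup : has_sup S.
  split.
    exists (- M' - M); have [y By] := B0; exists y => // n.
    have [k nk Ak] := Aoo n; exists k => //; split=> //.
    by have := uM' y By; have := fM k By; rewrite !ler_norml; lra.
  exists (M' + M) => t [y By /(_ 0%N)[k _ [_]]].
  by have := uM' y By; have := fM k By; rewrite !ler_norml; lra.
have [t [x Bx tS] st] := sup_adherent e0 Ssup.
exists [set k | A k /\ t <= u x - f k x]; split=> //; first by move=> k [].
exists (sup S); split=> [y d By d0|]; last first.
  by exists x => // k [_]; exact: lt_le_trans.
have nS : ~ S (sup S + d).
  by move=> /(sup_upper_bound Ssup); rewrite gerDl leNgt d0.
have /existsNP[n nn] : ~ unbounded [set k | A k /\ sup S + d <= u y - f k y].
  by move=> Sy; apply: nS; exists y.
exists n => k nk Ak; rewrite ltNge; apply/negP => le_k.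
by apply: nn; exists k.
Qed.

(* If [w] is a limit of blocks of the [f k] with [k] in [A n], then the
   supremum of [u q - w] over [B] is within [e] of [s]: it does not depend on
   [w]. *)
Lemma stabilize (Q : countType) (u : Q -> T -> R) :
  (forall q, exists M' : R, forall y, B y -> `|u q y| <= M') ->
  exists A : nat -> set nat,
    [/\ forall n, A n !=set0, forall n, A n.+1 `<=` A n,
        forall n k, A n k -> (n <= k)%N &
        forall q e, 0 < e -> exists s,
          (forall y d, B y -> 0 < d ->
            exists n, forall k, A n k -> u q y - f k y < s + d) /\
          (exists2 x, B x &
            exists n, forall k, A n k -> s - e < u q x - f k x)].
Proof.
move=> uM.
(* Step [i] decodes to a pair [(q, m)] and treats [u q] with tolerance [m.+1%:R^-1]. Numbers that
   encode no pair get the zero function and tolerance 1. *)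
pose u' i : T -> R :=
  if (unpickle i : option (Q * nat)) is Some (q, _) then u q else fun=> 0.
pose e' i : R :=
  if (unpickle i : option (Q * nat)) is Some (_, m) then m.+1%:R^-1 else 1.
have e'0 i : 0 < e' i.
  by rewrite /e'; case: (unpickle i : option (Q * nat)) => [[_ m]|].
have uM' i : exists M' : R, forall y, B y -> `|u' i y| <= M'.
  rewrite /u'; case: (unpickle i : option (Q * nat)) => [[q _]|]//.
  by exists 0 => y _; rewrite normr0.
pose good i (A A' : set nat) := exists s,
  (forall y d, B y -> 0 < d -> exists n, forall k, (n <= k)%N -> A k ->
    u' i y - f k y < s + d) /\
  (exists2 x, B x & forall k, A' k -> s - e' i < u' i x - f k x).
have /choice[F FP] : forall iA : nat * set nat, exists A',
    unbounded iA.2 -> [/\ A' `<=` iA.2, unbounded A' & good iA.1 iA.2 A'].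
  move=> [i A]; have [Aoo|nA] := pselect (unbounded A); last by exists A.
  have [M' uM'i] := uM' i.
  by have [A' ?] := stabilize_step Aoo uM'i (e'0 i); exists A'.
pose A := fix A n := if n is m.+1 then F (m, A m) else setT.
have Aoo n : unbounded (A n).
  elim: n => [|n IH]; first by move=> n; exists n.
  by have [] := FP (n, A n) IH.
have AS n : A n.+1 `<=` A n by have [] := FP (n, A n) (Aoo n).
have Agood n : good n (A n) (A n.+1) by have [] := FP (n, A n) (Aoo n).
have Amono m n : (m <= n)%N -> A n `<=` A m.
  elim: n => [|n IH]; first by rewrite leqn0 => /eqP->.
  rewrite leq_eqVlt => /predU1P[->//|mn].
  exact: subset_trans (AS n) (IH mn).
(* Removing the indices below [n] turns a claim about all large [k] of one set into a claim about
   all [k] of a later set. *)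
exists (fun n => A n `&` [set k | (n <= k)%N]); split.
- by move=> n; have [k nk Ak] := Aoo n n; exists k.
- by move=> n k [/AS Ak /ltnW].
- by move=> n k [].
move=> q e e0; have [m me] : exists m : nat, m.+1%:R^-1 < e.
  by have [m] := ltr_add_invr e0; rewrite add0r => ?; exists m.
have [s] := Agood (pickle (q, m)); rewrite /u' /e' pickleK => -[s1 [x Bx s2]].
exists s; split.
  move=> y d By d0; have [n nP] := s1 y d By d0.
  exists (maxn n (pickle (q, m))) => k [Ak /=].
  rewrite geq_max => /andP[nk ik]; apply: nP => //.
  by apply: Amono Ak; exact: leq_maxr.
exists x => //; exists (pickle (q, m)).+1 => k [Ak _].
by apply: le_lt_trans (s2 k Ak); rewrite lerD2l lerN2 ltW.
Qed.

End Stabilisation.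

(** * James' theorem for a complete seminorm *)

(** Compactness of the segment gives a cluster point, and a cluster point of an ultrafilter is a
    limit. *)
Lemma ultra_bounded_cvg (R : realType) (T : Type) (U : set_system T)
    (UU : UltraFilter U) (h : T -> R) (M : R) :
  (\forall t \near U, `|h t| <= M) -> cvg (h @ U).
Proof.
move=> hM; have PU := ultra_proper : ProperFilter U.
have [|l [_ hl]] := @segment_compact R (- M) M (h @ U) _.
  by near=> t; rewrite /= in_itv/= -ler_norml; near: t.
apply/cvg_ex; exists l => A lA.
have [//|UA] := in_ultra_setVsetC (h @^-1` A) UU.
by have [t []] := hl (~` A) A UA lA.
Unshelve. all: by end_near. Qed.

(** * Bounded functionals on a real seminormed space *)

Section Functionals.
Context {R : realType} {V : lmodType R}.
Variable N : V -> R.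
Hypothesis ND : forall x y, N (x + y) <= N x + N y.
Hypothesis NZ : forall a x, N (a *: x) = `|a| * N x.
Implicit Types (f g : V -> R) (x y : V).

(** Replacing [x] by [- x] makes the one-sided bound two-sided; the same holds for [dual_ball]. *)
Definition bounded_functional f := scalar f /\ exists M, forall x, f x <= M * N x.

Definition dual_ball f := scalar f /\ forall x, f x <= N x.

Lemma seminorm_sublinear : sublinear N.
Proof. by split=> // t x t0; rewrite NZ ger0_norm. Qed.

Lemma seminorm0 : N 0 = 0.
Proof. exact: sublinear0 seminorm_sublinear. Qed.

Lemma seminormN x : N (- x) = N x.
Proof. by rewrite -scaleN1r NZ normrN1 mul1r. Qed.

Lemma seminorm_ge0 x : 0 <= N x.
Proof.
by have := sublinearN x seminorm_sublinear; rewrite seminormN; lra.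
Qed.

Lemma scalarfD f x y : scalar f -> f (x + y) = f x + f y.
Proof. by move=> /(_ 1 x y); rewrite scale1r mul1r. Qed.

Lemma scalarf0 f : scalar f -> f 0 = 0.
Proof. by move=> fl; have := scalarfD 0 0 fl; rewrite addr0; lra. Qed.

Lemma scalarfZ f a x : scalar f -> f (a *: x) = a * f x.
Proof. by move=> fl; have := fl a x 0; rewrite scalarf0// !addr0. Qed.

Lemma scalarfN f x : scalar f -> f (- x) = - f x.
Proof. by move=> fl; rewrite -scaleN1r scalarfZ// mulN1r. Qed.

Lemma scalarfB f x y : scalar f -> f (x - y) = f x - f y.
Proof. by move=> fl; rewrite scalarfD// scalarfN. Qed.

Lemma scalarf_sum f n (l : 'I_n -> R) (x : 'I_n -> V) : scalar f ->
  f (\sum_i l i *: x i) = \sum_i l i * f (x i).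
Proof.
move=> fl; elim/big_rec2: _ => [|i a b _ <-]; first exact: scalarf0.
exact: fl.
Qed.

Lemma dual_ball_norm f x : dual_ball f -> `|f x| <= N x.
Proof.
move=> [fl fN]; rewrite ler_norml fN andbT.
by have := fN (- x); rewrite scalarfN// seminormN; lra.
Qed.

Lemma dual_ball_bounded f : dual_ball f -> bounded_functional f.
Proof. by move=> [fl fN]; split=> //; exists 1 => x; rewrite mul1r. Qed.

Lemma dual_ball0 : dual_ball (fun=> 0).
Proof.
by split=> [a x y|x]; [rewrite mulr0 addr0|exact: seminorm_ge0].
Qed.

Lemma dual_ballN f : dual_ball f -> dual_ball (fun x => - f x).
Proof.
move=> fb; have [fl _] := fb; split=> [a x y|x]; first by rewrite fl; ring.
by have := dual_ball_norm x fb; rewrite ler_norml; lra.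
Qed.

Lemma bounded_functional_lin a f g : bounded_functional f ->
  bounded_functional g -> bounded_functional (fun x => a * f x + g x).
Proof.
move=> [fl [M fM]] [gl [M' gM]]; split=> [b x y|]; first by rewrite fl gl; ring.
exists (`|a| * M + M') => x; rewrite mulrDl lerD// -mulrA.
have fMx : `|f x| <= M * N x.
  by rewrite ler_norml fM andbT; have := fM (- x); rewrite scalarfN// seminormN; lra.
by rewrite (le_trans (ler_norm _))// normrM ler_wpM2l.
Qed.

Lemma bounded_functional_sum n (l : 'I_n -> R) (f : 'I_n -> V -> R) :
  (forall i, bounded_functional (f i)) ->
  bounded_functional (fun x => \sum_i l i * f i x).
Proof.
elim: n l f => [|n IH] l f fb.
  rewrite [X in bounded_functional X](_ : _ = fun=> 0).
    exact: dual_ball_bounded dual_ball0.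
  by apply/funext => x; rewrite big_ord0.
rewrite [X in bounded_functional X](_ : _ = fun x =>
  l ord0 * f ord0 x + \sum_(i < n) l (lift ord0 i) * f (lift ord0 i) x).
  by apply: bounded_functional_lin => //; apply: IH.
by apply/funext => x; rewrite big_ord_recl.
Qed.

(** By homogeneity when [0 < N x]. On null vectors of the seminorm, the boundedness of [f] gives
    [f x <= 0]. *)
Lemma ball_bound f c : bounded_functional f ->
  (forall x, N x <= 1 -> f x <= c) -> forall x, f x <= c * N x.
Proof.
move=> [fl [M fM]] fc x.
have [Nx|Nx] := leP (N x) 0.
  have Nx0 : N x = 0 by apply/eqP; rewrite eq_le Nx seminorm_ge0.
  by have := fM x; rewrite Nx0 !mulr0.
have := fc ((N x)^-1 *: x).
rewrite NZ ger0_norm ?invr_ge0 ?(ltW Nx)// mulVf ?gt_eqF// lexx => /(_ isT).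
by rewrite scalarfZ// ler_pdivrMl// mulrC.
Qed.

Lemma norming_functional x : exists2 f, dual_ball f & f x = N x.
Proof.
by have [f fl [fx fN]] := hahn_banach_at x seminorm_sublinear; exists f.
Qed.

(** The compactness of the dual ball for pointwise convergence: [w] is the pointwise limit along an
    ultrafilter finer than [F]. *)
Lemma dual_ball_ultralimit (T : Type) (F : set_system T) {FF : ProperFilter F}
    (g : T -> V -> R) : (forall t, dual_ball (g t)) ->
  exists2 w, dual_ball w &
    forall y c, (\forall t \near F, c <= g t y) -> c <= w y.
Proof.
move=> gb; have [U [UU FU]] := ultraFilterLemma FF.
have PU := ultra_proper : ProperFilter U.
have gcv y : cvg (g ^~ y @ U).
  by apply: (@ultra_bounded_cvg _ _ _ _ _ (N y)); near=> t; exact: dual_ball_norm.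
exists (fun y => lim (g ^~ y @ U)); last first.
  by move=> y c cg; apply: limr_ge => //; exact: FU.
split=> [a x y|x].
  apply/cvg_lim => //.
  rewrite (_ : (fun t => _) = (fun t => a * g t x + g t y)).
    by apply: cvgD => //; apply: cvgM => //; exact: cvg_cst.
  by apply/funext => t; have [gl _] := gb t; exact: gl.
by apply: limr_le => //; near=> t; have [_] := gb t; exact.
Unshelve. all: by end_near. Qed.


(** * Elements of the bidual and the sequences of James *)

Section Bidual.
Variable Phi : (V -> R) -> R.
Hypothesis Phi_lin : forall a f g, bounded_functional f -> bounded_functional g ->
  Phi (fun x => a * f x + g x) = a * Phi f + Phi g.
Hypothesis Phi_le1 : forall f, dual_ball f -> Phi f <= 1.

Lemma bidual0 : Phi (fun=> 0) = 0.
Proof.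
have b0 := dual_ball_bounded dual_ball0.
have := Phi_lin 1 b0 b0.
have -> : (fun x : V => 1 * 0 + 0) = (fun=> 0 : R).
  by apply/funext => x; rewrite mulr0 addr0.
lra.
Qed.

Lemma bidualZ a f : bounded_functional f -> Phi (fun x => a * f x) = a * Phi f.
Proof.
move=> fb; have := Phi_lin a fb (dual_ball_bounded dual_ball0).
rewrite bidual0 addr0 => <-; congr Phi.
by apply/funext => x; rewrite addr0.
Qed.

Lemma bidualN f : bounded_functional f -> Phi (fun x => - f x) = - Phi f.
Proof.
move=> fb; rewrite -mulN1r -bidualZ//; congr Phi.
by apply/funext => x; rewrite mulN1r.
Qed.

Lemma bidual_norm f : dual_ball f -> `|Phi f| <= 1.
Proof.
move=> fb; rewrite ler_norml Phi_le1// andbT.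
have := Phi_le1 (dual_ballN fb).
by rewrite bidualN; [lra|exact: dual_ball_bounded].
Qed.

Lemma bidual_sum n (l : 'I_n -> R) (f : 'I_n -> V -> R) :
  (forall i, bounded_functional (f i)) ->
  Phi (fun x => \sum_i l i * f i x) = \sum_i l i * Phi (f i).
Proof.
elim: n l f => [|n IH] l f fb.
  rewrite big_ord0 -[RHS]bidual0; congr Phi.
  by apply/funext => x; rewrite big_ord0.
rewrite big_ord_recl -IH// -Phi_lin//; last exact: bounded_functional_sum.
by congr Phi; apply/funext => x; rewrite big_ord_recl.
Qed.

Lemma bidual_le f c : 0 < c -> bounded_functional f ->
  (forall x, f x <= c * N x) -> Phi f <= c.
Proof.
move=> c0 fb fc; have [fl _] := fb.
have : dual_ball (fun x => c^-1 * f x).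
  split=> [a x y|x]; first by rewrite fl; ring.
  by rewrite ler_pdivrMl.
by move=> /Phi_le1; rewrite bidualZ// ler_pdivrMl// mulr1.
Qed.

(** Without a gap, some [u n] approximates [Phi] within [n.+1%:R^-1] uniformly on the dual ball.
    Norming functionals show that [u] is Cauchy, and its limit would represent [Phi]. *)
Lemma bidual_gap :
  (forall u : nat -> V,
    (forall e, 0 < e -> exists n0, forall m n, (n0 <= m)%N -> (n0 <= n)%N ->
      N (u m - u n) <= e) ->
    exists x, forall e, 0 < e -> exists n0, forall n, (n0 <= n)%N ->
      N (u n - x) <= e) ->
  (forall x, exists2 f, dual_ball f & Phi f <> f x) ->
  exists2 d, 0 < d & forall x, exists2 f, dual_ball f & d <= Phi f - f x.
Proof.
move=> Ncomplete nPhi; apply: contrapT => nd.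
have /choice[u uP] : forall n : nat, exists x, forall f, dual_ball f ->
    `|Phi f - f x| < n.+1%:R^-1.
  move=> n; have : 0 < n.+1%:R^-1 :> R by rewrite invr_gt0.
  move: n.+1%:R^-1 => r r0; apply: contrapT => nu; apply: nd; exists r => //.
  move=> x; apply: contrapT => nf; apply: nu; exists x => f fb.
  rewrite ltr_norml; apply/andP; split.
    rewrite ltrNl ltNge; apply/negP => le_f; apply: nf.
    exists (fun y => - f y); first exact: dual_ballN.
    by rewrite /= bidualN; [lra|exact: dual_ball_bounded].
  by rewrite ltNge; apply/negP => le_f; apply: nf; exists f.
have small e : 0 < e -> exists n0, forall n, (n0 <= n)%N -> n.+1%:R^-1 <= e :> R.
  move=> e0; have [m] := ltr_add_invr e0; rewrite add0r => me; exists m => n mn.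
  by apply: le_trans (ltW me); rewrite lef_pV2 ?posrE// ler_nat.
have [e e0|x xP] := Ncomplete u.
  have [n0 n0e] := small (e / 2) (divr_gt0 e0 (ltr0Sn _ _)).
  exists n0 => m n mn nn; have [f fb <-] := norming_functional (u m - u n).
  have [fl _] := fb; rewrite scalarfB//.
  have := uP m f fb; have := uP n f fb; have := n0e m mn; have := n0e n nn.
  rewrite !ltr_norml; move: m.+1%:R^-1 n.+1%:R^-1 => a b; lra.
have [f fb] := nPhi x; apply; have [fl _] := fb.
suff : `|Phi f - f x| <= 0 by rewrite normr_le0 subr_eq0 => /eqP.
apply/ler_addgt0Pl => e e0; rewrite addr0.
have e20 : 0 < e / 2 by rewrite divr_gt0.
have [n1 n1e] := small _ e20; have [n2 n2e] := xP _ e20.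
pose n := maxn n1 n2.
have h1 := n1e n (leq_maxl _ _); have h2 := n2e n (leq_maxr _ _).
have h3 := uP n f fb; have := dual_ball_norm (u n - x) fb.
rewrite scalarfB//; move: n.+1%:R^-1 h1 h3 => a h1 h3 h4.
have -> : Phi f - f x = (Phi f - f (u n)) + (f (u n) - f x) by ring.
apply: le_trans (ler_normD _ _) _; lra.
Qed.

(** Helly's theorem in the dual ball, for the value of [Phi] (coordinate 0) and the evaluations at
    the [x j] (coordinate [j.+1]), with target [(d, 0, ..., 0)]. For a form with positive leading
    coefficient, the gap at a suitable combination of the [x j] provides the functional; otherwise 0
    does. *)
Lemma bidual_separation d n (x : nat -> V) e : 0 <= d -> 0 < e ->
  (forall x, exists2 f, dual_ball f & d <= Phi f - f x) ->
  exists2 f, dual_ball f &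
    d - e <= Phi f /\ forall j, (j < n)%N -> `|f (x j)| <= e.
Proof.
move=> d0 e0 gap.
pose ev (f : V -> R) (i : 'I_n.+1) := if val i is j.+1 then f (x j) else Phi f.
pose c (i : 'I_n.+1) := if val i is j.+1 then 0 else d.
have := @helly R n.+1 [set ev f | f in dual_ball] c
  (1 + \sum_(j < n) N (x j)).
move=> /(_ _ _ _ _ e e0)[||||_ [f fb <-] fe].
- by exists (ev (fun=> 0)); exists (fun=> 0) => //; exact: dual_ball0.
- move=> _ _ t [f fb <-] [g gb <-] /andP[t0 t1].
  exists (fun y => t * g y + (1 - t) * f y).
    have [fl fN] := fb; have [gl gN] := gb.
    split=> [a y z|y]; first by rewrite fl gl; ring.
    rewrite (_ : N y = t * N y + (1 - t) * N y); last by ring.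
    by rewrite lerD// ler_wpM2l// subr_ge0.
  have fB := dual_ball_bounded fb; have gB := dual_ball_bounded gb.
  apply/funext => -[[|j] jn]; rewrite /ev/=; last by ring.
  rewrite Phi_lin// ?bidualZ//; first by ring.
  have := bounded_functional_lin (1 - t) fB (dual_ball_bounded dual_ball0).
  by congr bounded_functional; apply/funext => y; rewrite addr0.
- move=> _ [[|j] jn] [f fb <-]; rewrite /ev/=.
    rewrite (le_trans (bidual_norm fb))// lerDl sumr_ge0// => i _.
    exact: seminorm_ge0.
  apply: le_trans (dual_ball_norm _ fb) _.
  rewrite (bigD1 (Ordinal (jn : (j < n)%N)))//= addrCA lerDl.
  rewrite addr_ge0// sumr_ge0// => i _; exact: seminorm_ge0.
- move=> l e' e'0.
  have cE : \sum_i l i * c i = l ord0 * d.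
    rewrite big_ord_recl big1 ?addr0// => i _; rewrite /c /= mulr0//.
  have [l0|l0] := leP (l ord0) 0.
    exists (ev (fun=> 0)); first by exists (fun=> 0) => //; exact: dual_ball0.
    rewrite cE big1 ?add0r.
      by rewrite (le_trans _ (ltW e'0))// mulr_le0_ge0.
    by move=> [[|i] ?] _; rewrite /ev/= ?bidual0 mulr0.
  have [f fb df] := gap (- (l ord0)^-1 *: \sum_(i < n) l (lift ord0 i) *: x i).
  have [fl _] := fb.
  exists (ev f); first by exists f.
  rewrite cE big_ord_recl/= -[leRHS]addrA.
  have -> : \sum_(i < n) l (lift ord0 i) * ev f (lift ord0 i) =
      \sum_(i < n) l (lift ord0 i) * f (x i) by [].
  rewrite -(@scalarf_sum f n)//; move: df; rewrite scalarfZ//.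
  rewrite -(ler_pM2l l0) mulNr mulrBr mulrN opprK mulrA divff ?gt_eqF// mul1r.
  rewrite /ev /=; lra.
exists f => //; split.
  by have := fe ord0; rewrite /ev /c /= ler_norml; lra.
by move=> j jn; have := fe (Ordinal (jn : (j.+1 < n.+1)%N)); rewrite /ev /c /= subr0.
Qed.

Hypothesis attain : forall f, bounded_functional f ->
  exists2 x0, N x0 <= 1 & forall x, N x <= 1 -> f x <= f x0.

Lemma goldstine n (f : nat -> V -> R) e : 0 < e ->
  (forall i, (i < n)%N -> dual_ball (f i)) ->
  exists2 x, N x <= 1 & forall i, (i < n)%N -> `|f i x - Phi (f i)| <= e.
Proof.
move=> e0 fb.
have fb' (i : 'I_n) : dual_ball (f i) by exact: fb.
have := @helly R n [set (fun i : 'I_n => f i x) | x in [set x | N x <= 1]]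
  (fun i => Phi (f i)) 1.
move=> /(_ _ _ _ _ e e0)[||||_ [x Nx <-] fe].
- by exists (fun i : 'I_n => f i 0); exists 0 => //=; rewrite seminorm0.
- move=> _ _ t [x Nx <-] [y Ny <-] /andP[t0 t1].
  exists ((1 - t) *: x + t *: y) => /=.
    rewrite (le_trans (ND _ _))// !NZ !ger0_norm ?subr_ge0//.
    have : (1 - t) * N x <= (1 - t) * 1 by rewrite ler_wpM2l// subr_ge0.
    have : t * N y <= t * 1 by rewrite ler_wpM2l.
    lra.
  apply/funext => i; have [fl _] := fb' i.
  by rewrite fl scalarfZ//; ring.
- move=> _ i [x Nx <-]; exact: le_trans (dual_ball_norm x (fb' i)) Nx.
- move=> l e' e'0.
  have fB i := dual_ball_bounded (fb' i).
  pose g x := \sum_(i < n) l i * f i x.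
  have gB : bounded_functional g by exact: bounded_functional_sum.
  have [x0 Nx0 gx0] := attain gB.
  exists (fun i : 'I_n => f i x0); first by exists x0.
  rewrite -bidual_sum//.
  have gx00 : 0 <= g x0.
    have [gl _] := gB; rewrite -(scalarf0 gl); apply: gx0.
    by rewrite seminorm0.
  (* The error [e'] makes the bound positive even when [g x0 = 0]. *)
  apply: bidual_le => //; first by rewrite ltr_wpDl.
  move=> x; rewrite (le_trans (ball_bound gB gx0 x))//.
  by rewrite ler_wpM2r ?seminorm_ge0// lerDl ltW.
by exists x => // i ilt; exact: (fe (Ordinal ilt)).
Qed.

(** Alternate the two lemmas with tolerance [d / 4]: first [f n], small at the earlier [x j] and
    with [d - d / 4 <= Phi (f n)]; then [x n], at which [f 0], ..., [f n] take nearly the values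
    that [Phi] gives them. *)
Lemma james_sequence d : 0 < d ->
  (forall x, exists2 f, dual_ball f & d <= Phi f - f x) ->
  exists (f : nat -> V -> R) (x : nat -> V), forall n,
    [/\ dual_ball (f n), N (x n) <= 1,
        forall i, (i <= n)%N -> d / 2 <= f i (x n) &
        forall j, (j < n)%N -> `|f n (x j)| <= d / 4].
Proof.
move=> d0 gap; have d40 : 0 < d / 4 by rewrite divr_gt0.
pose P n (u : nat -> (V -> R) * V) (t : (V -> R) * V) :=
  [/\ dual_ball t.1, N t.2 <= 1 /\ d - d / 4 <= Phi t.1,
      d / 2 <= t.1 t.2 /\ (forall i, (i < n)%N -> d / 2 <= (u i).1 t.2) &
      forall j, (j < n)%N -> `|t.1 (u j).2| <= d / 4].
have [|n u uP|u uP] := @history_choice _ (fun=> 0, 0) P.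
- move=> n u v t uv [t1 t2 [t3 t4] t5]; split=> //.
    by split=> // i i_n; rewrite -uv// t4.
  by move=> j jn; rewrite -uv// t5.
- have [f fb [Phif fx]] :=
    bidual_separation n (fun j => (u j).2) (ltW d0) d40 gap.
  pose h i := if (i < n)%N then (u i).1 else f.
  have hb i : (i < n.+1)%N -> dual_ball (h i).
    by move=> _; rewrite /h; case: ifP => // /uP[].
  have hP i : (i < n.+1)%N -> d - d / 4 <= Phi (h i).
    by move=> _; rewrite /h; case: ifP => // /uP[_ []].
  have [x Nx xh] := goldstine d40 hb.
  have hx i : (i < n.+1)%N -> d / 2 <= h i x.
    by move=> ilt; have := hP i ilt; have := xh i ilt; rewrite ler_norml; lra.
  exists (f, x); split=> //; split.
    by have := hx n (ltnSn n); rewrite /h ltnn.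
  by move=> i i_n; have := hx i (ltnW i_n); rewrite /h i_n.
exists (fun n => (u n).1), (fun n => (u n).2) => n.
have [h1 [h2 h3] [h4 h5] h6] := uP n; split=> // i.
by rewrite leq_eqVlt => /predU1P[->//|/h5].
Qed.

End Bidual.

(** Finitely supported rational coefficients are encoded as polynomials: these form a countable
    type, as [stabilize] requires, and a module over [rat], as [block_selection] requires. *)
Definition rat_comb (f : nat -> V -> R) (p : {poly rat}) y :=
  \sum_(i < size p) ratr p`_i * f i y.

Lemma rat_comb_widen (f : nat -> V -> R) (p : {poly rat}) n y : (size p <= n)%N ->
  rat_comb f p y = \sum_(i < n) ratr p`_i * f i y.
Proof.
move=> pn; rewrite /rat_comb (big_ord_widen n (fun i => ratr p`_i * f i y))//.
rewrite big_mkcond; apply: eq_bigr => i _; case: ltnP => // ip.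
by rewrite nth_default// rmorph0 mul0r.
Qed.

Lemma rat_comb_lin (f : nat -> V -> R) a p q y :
  rat_comb f (a *: p + q) y = ratr a * rat_comb f p y + rat_comb f q y.
Proof.
pose n := maxn (size (a *: p + q)) (maxn (size p) (size q)).
rewrite !(@rat_comb_widen f _ n) ?leq_max ?leqnn ?orbT//.
rewrite mulr_sumr -big_split/=; apply: eq_bigr => i _.
by rewrite coefD coefZ rmorphD rmorphM/=; ring.
Qed.

Lemma rat_comb0 (f : nat -> V -> R) y : rat_comb f 0 y = 0.
Proof. by rewrite /rat_comb size_poly0 big_ord0. Qed.

(** Since [p.[1]] is the sum of the coefficients, these are the rational convex combinations of
    indices in [A]. *)
Definition rat_hull (A : set nat) : set {poly rat} :=
  [set p : {poly rat} |
    [/\ forall i, 0 <= p`_i, p.[1] = 1 & forall i, p`_i != 0 -> A i]].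

Lemma rat_hullS A A' : A `<=` A' -> rat_hull A `<=` rat_hull A'.
Proof. by move=> AA' p [p0 p1 pA]; split=> // i /pA/AA'. Qed.

Lemma rat_hull_gen A k : A k -> rat_hull A 'X^k.
Proof.
move=> Ak; split=> [i||i].
- by rewrite coefXn; case: eqP.
- by rewrite hornerXn expr1n.
- by rewrite coefXn; case: (i =P k) => [->//|_]; rewrite eqxx.
Qed.

Lemma rat_hull_conv A D a b : 0 <= D <= 1 -> rat_hull A a -> rat_hull A b ->
  rat_hull A ((1 - D) *: a + D *: b).
Proof.
move=> /andP[D0 D1] [a0 a1 aA] [b0 b1 bA]; split=> [i||i].
- by rewrite coefD !coefZ addr_ge0// mulr_ge0// subr_ge0.
- by rewrite hornerD !hornerZ a1 b1; ring.
- rewrite coefD !coefZ; have [/eqP ai|/aA//] := boolP (a`_i == 0).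
  have [/eqP bi|/bA//] := boolP (b`_i == 0).
  by rewrite ai bi !mulr0 addr0 eqxx.
Qed.

Lemma rat_hull_ge (f : nat -> V -> R) A p c y :
  rat_hull A p -> (forall k, A k -> c <= f k y) ->
  c <= rat_comb f p y.
Proof.
move=> [p0 p1 pA] fc; rewrite /rat_comb.
have -> : c = \sum_(i < size p) ratr p`_i * c.
  rewrite -mulr_suml -rmorph_sum/=.
  have -> : \sum_(i < size p) p`_i = p.[1].
    by rewrite horner_coef; apply: eq_bigr => i _; rewrite expr1n mulr1.
  by rewrite p1 rmorph1 mul1r.
apply: ler_sum => i _; have [->|pi0] := eqVneq p`_i 0.
  by rewrite rmorph0 !mul0r.
by rewrite ler_wpM2l ?ler0q//; apply: fc; exact: pA.
Qed.

Lemma rat_comb_scalar (f : nat -> V -> R) p :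
  (forall n, scalar (f n)) -> scalar (rat_comb f p).
Proof.
move=> fl a x y; rewrite /rat_comb mulr_sumr -big_split/=.
by apply: eq_bigr => i _; rewrite (fl i); ring.
Qed.

Lemma rat_hull_dual_ball (f : nat -> V -> R) A p :
  (forall n, dual_ball (f n)) -> rat_hull A p ->
  dual_ball (rat_comb f p).
Proof.
move=> fb pA; have fl n : scalar (f n) by case: (fb n).
have cl := rat_comb_scalar p fl; split=> // x.
rewrite -[x in leLHS]opprK scalarfN// lerNl.
apply: (rat_hull_ge pA) => k _.
by have := dual_ball_norm (- x) (fb k); rewrite seminormN ler_norml => /andP[].
Qed.

Lemma geometric_small (D e : R) : 0 < D < 1 -> 0 < e ->
  exists n0, forall n, (n0 <= n)%N -> D ^+ n < e.
Proof.
move=> /andP[D0 D1] e0.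
have /cvgrPdist_lt/(_ _ e0)[n0 _ n0P] : (fun n => D ^+ n) @ \oo --> (0 : R).
  by apply: cvg_expr; rewrite ger0_norm// ltW.
exists n0 => n /n0P /=; rewrite sub0r normrN ger0_norm// exprn_ge0// ltW//.
Qed.

(** * A functional that does not attain its norm *)

Section JamesContradiction.
Variables (f : nat -> V -> R) (x : nat -> V) (th : R).
Hypothesis th0 : 0 < th.
Hypothesis fb : forall n, dual_ball (f n).
Hypothesis xB : forall n, N (x n) <= 1.
Hypothesis fx_big : forall n i, (i <= n)%N -> 2 * th <= f i (x n).
Hypothesis fx_small : forall n i, (n < i)%N -> `|f i (x n)| <= th.

Let B := [set y | N y <= 1].

(** Applied to [y] and [- y], the condition says that [w y] lies in the closed convex hull of the
    [f k y] with [k] in [A n], for every [n]; pointwise limits of convex blocks have this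
    property. *)
Definition block_limit (A : nat -> set nat) (w : V -> R) :=
  dual_ball w /\ forall n y c, (forall k, A n k -> c <= f k y) -> c <= w y.

Lemma block_limit_exists (A : nat -> set nat) (g : nat -> {poly rat}) :
  (forall n, A n.+1 `<=` A n) -> (forall n, rat_hull (A n) (g n)) ->
  exists2 w, block_limit A w & forall y c,
    (\forall n \near \oo, c <= rat_comb f (g n) y) -> c <= w y.
Proof.
move=> AS gA.
have gb n : dual_ball (rat_comb f (g n)) by exact: rat_hull_dual_ball (gA n).
have [w wb wP] := dual_ball_ultralimit (F := \oo) gb.
exists w => //; split=> // n y c fc; apply: wP.
have Amono m : (n <= m)%N -> A m `<=` A n.
  elim: m => [|m IH]; first by rewrite leqn0 => /eqP->.
  rewrite leq_eqVlt => /predU1P[->//|nm].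
  exact: subset_trans (AS m) (IH nm).
exists n => // m /= nm.
by apply: (rat_hull_ge (gA m)) => k /(Amono _ nm); exact: fc.
Qed.

(** For each [e], [stabilize] gives one [s] that approximates within [e] the supremum of
    [rat_comb f p y - w y] for all block limits [w] at once. Hence the supremum is the same for all
    of them, and [nu] computes it with a fixed [w0]. *)
Lemma block_limit_norm :
  exists A : nat -> set nat, [/\ forall n, A n !=set0,
    forall n, A n.+1 `<=` A n, forall n k, A n k -> (n <= k)%N &
    exists nu : {poly rat} -> R, forall w, block_limit A w -> forall p,
      (forall y, B y -> rat_comb f p y - w y <= nu p) /\
      (forall e, 0 < e -> exists2 y, B y & nu p - e < rat_comb f p y - w y)].
Proof.
have B0 : B !=set0 by exists 0; rewrite /B /= seminorm0.
have f1 k y : B y -> `|f k y| <= 1.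
  by move=> By; exact: le_trans (dual_ball_norm y (fb k)) By.
have combB p : exists M : R, forall y, B y -> `|rat_comb f p y| <= M.
  exists (\sum_(i < size p) `|ratr p`_i|) => y By.
  apply: le_trans (ler_norm_sum _ _ _) _; apply: ler_sum => i _.
  by rewrite normrM ler_piMr// f1.
have [A [A0 AS Age Astab]] := stabilize B0 f1 combB.
exists A; split=> //.
have [k kA] := choice A0.
have [|w0 w0A _] := @block_limit_exists A (fun n => 'X^(k n)) AS.
  by move=> n; exact: rat_hull_gen.
have near w p e : block_limit A w -> 0 < e -> exists2 s,
    forall w, block_limit A w -> forall y, B y -> rat_comb f p y - w y <= s &
    forall w, block_limit A w -> exists2 y, B y & s - e <= rat_comb f p y - w y.
  move=> wA e0; have [s [sle [y By [n sge]]]] := Astab p e e0.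
  exists s => {w wA} w [[wl _] wA].
    move=> z Bz; apply/ler_addgt0Pl => d d0; have [m mP] := sle z d Bz d0.
    rewrite lerBlDr -lerBlDl; apply: (wA m) => i /mP; lra.
  exists y => //; rewrite lerBrDl -lerBrDr -lerN2 -(scalarfN y wl).
  apply: (wA n) => i /sge; have [fl _] := fb i; rewrite scalarfN//; lra.
pose E p := [set rat_comb f p y - w0 y | y in B].
have Esup p : has_sup (E p).
  split; first by have [y By] := B0; exists (rat_comb f p y - w0 y); exists y.
  have [s sP _] := near w0 p 1 w0A ltr01.
  by exists s => _ [y By <-]; exact: sP.
exists (fun p => sup (E p)) => w wA p; split=> [y By|e e0].
  apply/ler_addgt0Pl => e e0; have [s s1 s2] := near w p e wA e0.
  have [z Bz sz] := s2 w0 w0A; have := s1 w wA y By.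
  have : rat_comb f p z - w0 z <= sup (E p).
    by apply: sup_upper_bound => //; exists z.
  lra.
have e20 : 0 < e / 2 by rewrite divr_gt0.
have [s s1 s2] := near w p (e / 2) wA e20.
have [z Bz sz] := s2 w wA; exists z => //.
have : sup (E p) <= s.
  apply: ge_sup; first by case: (Esup p).
  by move=> _ [y By <-]; exact: s1.
lra.
Qed.

Lemma james_contradiction :
  ~ (forall h, bounded_functional h ->
    exists2 x0, N x0 <= 1 & forall y, N y <= 1 -> h y <= h x0).
Proof.
move=> attain.
have [A [A0 AS Age [nu nuP]]] := block_limit_norm.
pose C n := rat_hull (A n).
have C0 n : C n !=set0 by have [k Ak] := A0 n; exists 'X^k; exact: rat_hull_gen.
have CS n : C n.+1 `<=` C n by exact: rat_hullS.
have [k kA] := choice A0.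
have [|w0 w0A _] := @block_limit_exists A (fun n => 'X^(k n)) AS.
  by move=> n; exact: rat_hull_gen.
(* The ratio [D] is rational so as to act on polynomials, and so small that errors of order [dl] do
   not exhaust [th] in [G_big]. *)
have [m mth] : exists m, m.+1%:R^-1 < th / 32.
  have th32 : 0 < th / 32 by rewrite divr_gt0.
  by have [m] := ltr_add_invr th32; rewrite add0r; exists m.
pose D : rat := m.+2%:R^-1; pose dl : R := ratr D.
have dlE : dl = m.+2%:R^-1 by rewrite /dl /D fmorphV rmorph_nat.
have dl0 : 0 < dl by rewrite dlE invr_gt0.
have dl2 : dl <= 1 / 2 by rewrite dlE div1r lef_pV2 ?posrE// ler_nat.
have dlth : 32 * dl < th.
  have : dl <= m.+1%:R^-1 by rewrite dlE lef_pV2 ?posrE// ler_nat.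
  by move: m.+1%:R^-1 mth => r; lra.
have D01 : 0 <= D <= 1.
  by rewrite invr_ge0 ler0n/= invf_le1// ler1n.
have CD n a b : C n a -> C n b -> C n ((1 - D) *: a + D *: b).
  exact: rat_hull_conv.
pose de := th / 4.
have de0 : 0 < de by rewrite divr_gt0.
(* With this choice the errors add up to the geometric sum in [a_le] below. *)
pose eps n : R := de * dl * (dl ^+ n) ^+ 2.
have eps0 n : 0 < eps n.
  exact: mulr_gt0 (mulr_gt0 de0 dl0) (exprn_gt0 _ (exprn_gt0 _ dl0)).
have nuC a : C 0%N a -> th <= nu a <= 2.
  move=> aC; apply/andP; split.
    (* All indices in [a] are below [size a], so at [x (size a)] the combination is at least
       [2 * th], while [w0], governed by indices above [size a], is at most [th]. *)
    apply: le_trans ((nuP _ w0A a).1 (x (size a)) (xB _)).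
    have h1 : 2 * th <= rat_comb f a (x (size a)).
      have [a0 a1 aA] := aC.
      have aC' : rat_hull [set i | (i < size a)%N] a.
        split=> // i; rewrite /= ltnNge; apply: contraNN => ai.
        by rewrite nth_default.
      by apply: (rat_hull_ge aC') => i /= /ltnW; exact: fx_big.
    have h2 : w0 (x (size a)) <= th.
      have [[wl _] wA] := w0A; rewrite -lerN2 -(scalarfN _ wl).
      apply: (wA (size a).+1) => i /Age ai; have [fl _] := fb i.
      rewrite scalarfN// lerN2; apply: le_trans (ler_norm _) _.
      exact: fx_small.
    lra.
  apply/ler_addgt0Pl => e e0; have [y By nuy] := (nuP _ w0A a).2 e e0.
  have := dual_ball_norm y (rat_hull_dual_ball fb aC).
  have := dual_ball_norm y w0A.1; rewrite /B/= in By.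
  rewrite !ler_norml; lra.
have [g [al [gC vC thal nu_le nu_lim]]] := block_selection C0 CS CD eps0 nuC.
have [w wA w_lim] := block_limit_exists AS gC.
pose G n := rat_comb f (g n); pose v n := rat_comb f (block D g n).
have Gb n : dual_ball (G n) by exact: rat_hull_dual_ball (gC n).
have vb n : dual_ball (v n) by exact: rat_hull_dual_ball (vC n).
have partialS n y : rat_comb f (partial_block D g n.+1) y =
    rat_comb f (partial_block D g n) y + (dl ^+ n - dl ^+ n.+1) * G n y.
  by rewrite partial_blockS addrC rat_comb_lin addrC rmorphB !rmorphXn.
have vE n y : v n y = rat_comb f (partial_block D g n) y + dl ^+ n * G n y.
  by rewrite /v /block addrC rat_comb_lin addrC rmorphXn.
have vS n y : v n.+1 y - v n y = dl ^+ n.+1 * (G n.+1 y - G n y).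
  by rewrite !vE partialS; ring.
(* The bound telescopes: one step costs at most [2 * dl ^+ p.+1], which is at most
   [4 * (dl ^+ p.+1 - dl ^+ p.+2)] because [dl <= 1 / 2]. *)
have v_cauchy n p y : B y -> (n <= p)%N ->
    `|v p y - v n y| <= 4 * (dl ^+ n.+1 - dl ^+ p.+1).
  move=> By; elim: p => [|p IH].
    by rewrite leqn0 => /eqP->; rewrite !subrr normr0 mulr0.
  rewrite leq_eqVlt => /predU1P[->|np]; first by rewrite !subrr normr0 mulr0.
  have -> : v p.+1 y - v n y = (v p.+1 y - v p y) + (v p y - v n y) by ring.
  apply: le_trans (ler_normD _ _) _; rewrite vS normrM.
  have G1 q : `|G q y| <= 1 by apply: le_trans By; exact: dual_ball_norm.
  have GG : `|G p.+1 y - G p y| <= 2.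
    by apply: le_trans (ler_normB _ _) _; have := G1 p; have := G1 p.+1; lra.
  have dp : 0 <= dl ^+ p.+1 by rewrite exprn_ge0// ltW.
  rewrite (ger0_norm dp); have := IH np.
  have : dl ^+ p.+1 * `|G p.+1 y - G p y| <= dl ^+ p.+1 * 2 by rewrite ler_wpM2l.
  have : dl ^+ p.+1 * dl <= dl ^+ p.+1 * (1 / 2) by rewrite ler_wpM2l.
  rewrite (exprSr dl p.+1); lra.
have [u ub u_lim] := dual_ball_ultralimit (F := \oo) vb.
have ul : scalar u by case: ub.
have uv n y : B y -> `|u y - v n y| <= 4 * dl ^+ n.+1.
  have vl : scalar (v n) by case: (vb n).
  have half z : B z -> v n z - 4 * dl ^+ n.+1 <= u z.
    move=> Bz; apply: u_lim; exists n => // p /= np.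
    have := v_cauchy n p z Bz np; rewrite ler_norml.
    have : 0 <= dl ^+ p.+1 by rewrite exprn_ge0// ltW.
    lra.
  move=> By; have BNy : B (- y) by rewrite /B/= seminormN.
  have := half _ By; have := half _ BNy; rewrite !scalarfN// ler_norml; lra.
have wl : scalar w by case: wA => -[].
have hB : bounded_functional (fun y => u y - w y).
  have := bounded_functional_lin (-1) (dual_ball_bounded wA.1) (dual_ball_bounded ub).
  by congr bounded_functional; apply/funext => y; ring.
have [x0 Bx0 hx0] := attain _ hB.
have al_le : al <= u x0 - w x0.
  (* Six errors of size [e / 6]: one from [nu_lim], one from the near-maximiser [y], and four from
     the distance between [u] and [v n]. *)
  apply/ler_addgt0Pl => e e0; have e30 : 0 < e / 6 by rewrite divr_gt0.
  have [n1 n1P] := nu_lim _ e30.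
  have dl01 : 0 < dl < 1 by rewrite dl0/=; lra.
  have [n2 n2P] := geometric_small dl01 e30.
  pose n := maxn n1 n2.
  have [y By nuy] := (nuP _ wA (block D g n)).2 _ e30.
  have := hx0 y By; have := uv n y By; have := n1P n (leq_maxl _ _).
  have := n2P n.+1 (leqW (leq_maxr _ _)).
  rewrite -/(v n) in nuy; rewrite ler_norml; lra.
pose a n := rat_comb f (partial_block D g n) x0 - (1 - dl ^+ n) * w x0.
have va n : v n x0 - w x0 = a n + dl ^+ n * (G n x0 - w x0).
  by rewrite vE /a; ring.
have va_le n : v n x0 - w x0 <= al + eps n.
  exact: le_trans ((nuP _ wA _).1 _ Bx0) (nu_le n).
(* The bound is [al] times the mass [1 - dl ^+ n] of the partial block, plus the accumulated error
   [de * (1 - dl ^+ n) * dl ^+ n]. *)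
have a_le n : a n <= al - (al - de * (1 - dl ^+ n)) * dl ^+ n.
  elim: n => [|n IH].
    rewrite /a /partial_block big_ord0 rat_comb0 expr0; lra.
  have -> : a n.+1 = dl * a n + (1 - dl) * (v n x0 - w x0).
    by rewrite va /a partialS exprSr; ring.
  have h1 : dl * a n <= dl * (al - (al - de * (1 - dl ^+ n)) * dl ^+ n).
    by rewrite ler_pM2l.
  have h2 : (1 - dl) * (v n x0 - w x0) <= (1 - dl) * (al + eps n).
    by rewrite ler_wpM2l//; lra.
  apply: le_trans (lerD h1 h2) _.
  by rewrite exprSr /eps le_eqVlt; apply/orP; left; apply/eqP; ring.
(* The whole block has value at least [al - 4 * dl ^+ n.+1] at [x0], and the partial block is
   bounded by [a_le]. Dividing the difference by [dl ^+ n] leaves at least [al - 4 * dl - de] for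
   the last vector. *)
have G_big n : w x0 + th / 4 <= G n x0.
  have t0 : 0 < dl ^+ n by rewrite exprn_gt0.
  have := uv n x0 Bx0; rewrite ler_norml exprSr => /andP[_ uvn].
  have := a_le n; have := va n => van an.
  have : 0 <= dl ^+ n * (G n x0 - w x0 + 4 * dl - al + de * (1 - dl ^+ n)).
    lra.
  rewrite pmulr_rge0//.
  have : de * (1 - dl ^+ n) <= de * 1 by rewrite ler_pM2l//; lra.
  rewrite /de; lra.
have : w x0 + th / 4 <= w x0 by apply: w_lim; near=> n; exact: G_big.
lra.
Unshelve. all: by end_near. Qed.

End JamesContradiction.

(** Scaling by [M'] puts [Phi] in the unit ball of the bidual. If no vector represents it on the
    dual ball, there is a gap [d], and the sequences of [james_sequence] yield the contradiction
    with [th = d / 4]. *)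
Theorem james (Phi : (V -> R) -> R) (M : R) :
  (forall u : nat -> V,
    (forall e, 0 < e -> exists n0, forall m n, (n0 <= m)%N -> (n0 <= n)%N ->
      N (u m - u n) <= e) ->
    exists x, forall e, 0 < e -> exists n0, forall n, (n0 <= n)%N ->
      N (u n - x) <= e) ->
  (forall h, bounded_functional h ->
    exists2 x0, N x0 <= 1 & forall y, N y <= 1 -> h y <= h x0) ->
  (forall a f g, bounded_functional f -> bounded_functional g ->
    Phi (fun x => a * f x + g x) = a * Phi f + Phi g) ->
  (forall f, dual_ball f -> Phi f <= M) ->
  exists x, forall f, bounded_functional f -> Phi f = f x.
Proof.
move=> Ncomplete attain Philin PhiM.
pose M' := Num.max M 1; have M'0 : 0 < M' by rewrite lt_max ltr01 orbT.
pose Psi f := M'^-1 * Phi f.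
have Psilin a f g : bounded_functional f -> bounded_functional g ->
    Psi (fun x => a * f x + g x) = a * Psi f + Psi g.
  by move=> fb gb; rewrite /Psi Philin//; ring.
have Psi1 f : dual_ball f -> Psi f <= 1.
  by move=> /PhiM fM; rewrite /Psi ler_pdivrMl// mulr1 le_max fM.
have [[x Psix]|nx] :=
    pselect (exists x, forall f, dual_ball f -> Psi f = f x).
  exists (M' *: x) => f [fl [c fc]].
  pose c' := Num.max c 1; have c'0 : 0 < c' by rewrite lt_max ltr01 orbT.
  have fb : dual_ball (fun y => c'^-1 * f y).
    split=> [a y z|y]; first by rewrite fl; ring.
    rewrite ler_pdivrMl// (le_trans (fc y))// ler_wpM2r ?seminorm_ge0//.
    by rewrite le_max lexx.
  have := Psix _ fb; rewrite (bidualZ Psilin)//; last by split=> //; exists c.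
  rewrite scalarfZ// => /(mulfI _); rewrite invr_eq0 gt_eqF// => /(_ isT) <-.
  by rewrite /Psi mulrA divff ?gt_eqF// mul1r.
have [|d d0 gap] := bidual_gap Psilin Ncomplete.
  move=> x; apply: contrapT => nf; apply: nx; exists x => f fb.
  by apply: contrapT => fx; apply: nf; exists f.
have [f [x fx]] := james_sequence Psilin Psi1 attain d0 gap.
have d40 : 0 < d / 4 by rewrite divr_gt0.
exfalso; apply: (@james_contradiction f x _ d40) attain.
- by move=> n; case: (fx n).
- by move=> n; case: (fx n).
- by move=> n i ilen; case: (fx n) => _ _ /(_ i ilen) + _; lra.
- by move=> n i ni; case: (fx i) => _ _ _; apply.
Qed.

End Functionals.

(** * Real and complex scalars *)

(* [re_repr] is what turns real functionals into [K]-linear ones of the same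
   norm. *)
Record scalar_structure (R : realType) (K : numFieldType) := ScalarStructure {
  of_real : {rmorphism R -> K};
  re : K -> R;
  ler_of_real : forall a b, (of_real a <= of_real b) = (a <= b);
  re_lin : forall a z w, re (of_real a * z + w) = a * re z + re w;
  norm_of_real : forall z : K, `|z| = of_real (re `|z|);
  re_le_norm : forall z : K, re z <= re `|z|;
  re_repr : forall l : K -> R,
    (forall a z w, l (of_real a * z + w) = a * l z + l w) ->
    exists c, forall z, l z = re (z * c)
}.

Lemma real_scalars (R : realType) : scalar_structure R R.
Proof.
apply: (@ScalarStructure R R idfun idfun) => //= [z|l llin].
  exact: ler_norm.
exists (l 1) => z; have := llin z 1 0; rewrite /= mulr1 addr0 => ->.
by have := llin 1 0 0; rewrite /= !mul1r addr0; lra.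
Qed.

Lemma complex_scalars (R : realType) : scalar_structure R R[i].
Proof.
apply: (@ScalarStructure R R[i] (real_complex R) (@complex.Re R)).
- exact: lecR.
- by move=> a [b c] [d e] /=; rewrite mul0r subr0.
- by move=> z; rewrite normc_def.
- move=> z; have := normc_ge_Re z; rewrite normc_def /= lecR.
  by apply: le_trans; exact: ler_norm.
(* The real part of [(a +i* b) * c] for this [c] is [a * l 1 + b * l 'i]. *)
- move=> l llin; exists (l 1 -i* l 'i)%C => -[a b].
  have l0 : l 0 = 0 by have := llin 1 0 0; rewrite rmorph1 !mul1r addr0; lra.
  have -> : (a +i* b)%C = real_complex R a * 1 + (real_complex R b * 'i%C + 0).
    by apply/eqP; rewrite eq_complex /=; apply/andP; split; apply/eqP; ring.
  rewrite !llin l0 /=; ring.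
Qed.

Section Scalars.
Context {R : realType} {K : numFieldType} (S : scalar_structure R K).
Notation of_real := (of_real S).
Notation re := (re S).
Implicit Types (a b : R) (z w c : K).

Lemma ltr_of_real a b : (of_real a < of_real b) = (a < b).
Proof. by rewrite !lt_leAnge !ler_of_real. Qed.

Lemma of_real_inj : injective of_real.
Proof. by move=> a b ab; apply: le_anti; rewrite -!(ler_of_real S) ab lexx. Qed.

Lemma re0 : re 0 = 0.
Proof. by have := re_lin S 1 0 0; rewrite rmorph1 mul1r addr0; lra. Qed.

Lemma reD z w : re (z + w) = re z + re w.
Proof. by have := re_lin S 1 z w; rewrite rmorph1 !mul1r. Qed.

Lemma reZ a z : re (of_real a * z) = a * re z.
Proof. by have := re_lin S a z 0; rewrite re0 !addr0. Qed.

Lemma reN z : re (- z) = - re z.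
Proof. by have := reZ (-1) z; rewrite rmorphN1 !mulN1r. Qed.

Lemma re1 : re 1 = 1.
Proof.
by apply: of_real_inj; rewrite rmorph1 -[in LHS](normr1 K) -(norm_of_real S) normr1.
Qed.

Lemma ge0_of_real z : 0 <= z -> of_real (re z) = z.
Proof. by move=> z0; rewrite -[z in RHS]ger0_norm// (norm_of_real S) ger0_norm. Qed.

Lemma ler_re z w : z <= w -> re z <= re w.
Proof.
rewrite -subr_ge0 => zw; rewrite -subr_ge0 -reN -reD -(ler_of_real S) rmorph0.
by rewrite ge0_of_real.
Qed.

Lemma normr_of_real a : `|of_real a| = of_real `|a|.
Proof.
have [a0|a0] := leP 0 a.
  by rewrite (ger0_norm a0) ger0_norm// -(rmorph0 of_real) ler_of_real.
by rewrite (ltr0_norm a0) ltr0_norm ?rmorphN// -(rmorph0 of_real) ltr_of_real.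
Qed.

Lemma norm_re z : `|re z| <= re `|z|.
Proof.
by rewrite ler_norml re_le_norm andbT lerNl -reN -(normrN z) re_le_norm.
Qed.

(** A rotation turns a modulus into a real part; bounds on real parts thus become bounds on
    norms. *)
Lemma unimodular_mul z : exists2 w, `|w| = 1 & w * z = `|z|.
Proof.
have [->|z0] := eqVneq z 0; first by exists 1; rewrite ?normr1// mulr0 normr0.
exists (`|z| / z); last by rewrite divfK.
by rewrite normf_div normr_id divff// normr_eq0.
Qed.

Lemma re_mul_inj z w : (forall c, re (c * z) = re (c * w)) -> z = w.
Proof.
move=> zw; apply/eqP; rewrite -subr_eq0 -normr_eq0; apply/eqP.
have [c _ cE] := unimodular_mul (z - w).
by rewrite (norm_of_real S) -cE mulrBr reD reN zw subrr rmorph0.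
Qed.

(** The limit of [re (z * h t)] exists for each [z] and is real-linear in [z], so [re_repr] yields
    [c]. *)
Lemma scalar_ultralimit (T : Type) (U : set_system T) (UU : UltraFilter U)
    (h : T -> K) (M : R) : (\forall t \near U, re `|h t| <= M) ->
  exists c, forall z, re (z * h t) @[t --> U] --> re (z * c).
Proof.
move=> hM; have PU := ultra_proper : ProperFilter U.
have hcv z : cvg (re (z * h t) @[t --> U]).
  apply: (@ultra_bounded_cvg _ _ _ _ _ (re `|z| * M)).
  near=> t; apply: le_trans (norm_re _) _.
  rewrite normrM [in leLHS](norm_of_real S z) reZ ler_wpM2l//.
    exact: le_trans (normr_ge0 _) (norm_re z).
  by near: t.
have [|c cP] := @re_repr _ _ S (fun z => lim (re (z * h t) @[t --> U])).
  move=> a z w; apply/cvg_lim => //.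
  rewrite (_ : (fun t => _) = (fun t => a * re (z * h t) + re (w * h t))).
    by apply: cvgD => //; apply: cvgM => //; exact: cvg_cst.
  by apply/funext => t; rewrite mulrDl -mulrA re_lin.
by exists c => z; rewrite -cP; exact: hcv.
Unshelve. all: by end_near. Qed.

(** The limit along a finer ultrafilter exists by boundedness, and the Cauchy property carries it
    over to [F]. *)
Lemma scalar_complete (F : set_system K^o) : ProperFilter F -> cauchy F -> cvg F.
Proof.
move=> FF Fc.
have Fex e : 0 < e -> exists z : K, \forall w \near F, `|z - w| < e.
  move=> e0; have /cauchyP/(_ e e0)[z zF] := Fc; exists z.
  by move: zF; apply: filterS => w; rewrite -ball_normE.
have [U [UU FU]] := ultraFilterLemma FF.
have PU := ultra_proper : ProperFilter U.
have [z0 z0F] := Fex 1 ltr01.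
have [|c cP] := @scalar_ultralimit _ U UU id (re `|z0| + 1).
  apply: FU; move: z0F; apply: filterS => w /= w1.
  rewrite -re1 -reD; apply: ler_re; rewrite -[w](subrK z0) addrC.
  by rewrite (le_trans (ler_normD _ _))// lerD2l distrC ltW.
apply/cvg_ex; exists c; apply/cvgrPdist_lt => e e0.
have [z zF] := Fex (e / 2) (divr_gt0 e0 (ltr0Sn _ _)).
have zc : `|c - z| <= e / 2.
  have e20 : 0 <= e / 2 by rewrite divr_ge0 ?ltW.
  rewrite (norm_of_real S) -(ge0_of_real e20) ler_of_real.
  have [d d1 <-] := unimodular_mul (c - z); rewrite mulrBr reD reN.
  rewrite lerBlDr -(cvg_lim _ (cP d))//; apply: limr_le.
    by apply/cvg_ex; exists (re (d * c)).
  apply: FU; move: zF; apply: filterS => w zw.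
  rewrite -lerBlDr -reN -reD -mulrBr (le_trans (re_le_norm _ _))//.
  by apply: ler_re; rewrite normrM d1 mul1r distrC ltW.
move: zF; apply: filterS => w zw.
rewrite -[c](subrK z) -addrA (le_lt_trans (ler_normD _ _))//.
by rewrite [e]splitr ler_ltD.
Qed.

End Scalars.

(** An alias of [X] on which real numbers act through [of_real]; [S] is a parameter so that the type
    determines this action. *)
Definition real_form (R : realType) (K : numFieldType)
  (S : scalar_structure R K) (X : lmodType K) : Type := X.

Section RealForm.
Context {R : realType} {K : numFieldType} (S : scalar_structure R K).
Variable X : lmodType K.

HB.instance Definition _ := GRing.Zmodule.on (real_form S X).

Let real_scale (a : R) (x : real_form S X) : real_form S X :=
  of_real S a *: (x : X).

Let real_scaleA a b x : real_scale a (real_scale b x) = real_scale (a * b) x.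
Proof. by rewrite /real_scale scalerA rmorphM. Qed.

Let real_scale1 : left_id 1 real_scale.
Proof. by move=> x; rewrite /real_scale rmorph1 scale1r. Qed.

Let real_scaleDr : right_distributive real_scale +%R.
Proof. by move=> a x y; rewrite /real_scale scalerDr. Qed.

Let real_scaleDl x : {morph real_scale^~ x : a b / a + b}.
Proof. by move=> a b; rewrite /real_scale rmorphD scalerDl. Qed.

HB.instance Definition _ := GRing.Zmodule_isLmodule.Build R (real_form S X)
  real_scaleA real_scale1 real_scaleDr real_scaleDl.

End RealForm.

(** The field as a Banach space over itself; the alias records [S], from which completeness is
    derived. *)
Definition scalar_line (R : realType) (K : numFieldType)
  (S : scalar_structure R K) : Type := K^o.

HB.instance Definition _ (R : realType) (K : numFieldType)
  (S : scalar_structure R K) := NormedModule.on (scalar_line S).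

HB.instance Definition _ (R : realType) (K : numFieldType)
  (S : scalar_structure R K) :=
  Uniform_isComplete.Build (scalar_line S) (@scalar_complete R K S).

(** * Norm attaining operators *)

Section Transfer.
Context {R : realType} {K : numFieldType} (S : scalar_structure R K).
Notation of_real := (of_real S).
Notation re := (re S).

Definition rnorm (X : normedModType K) (x : X) : R := re `|x|.

Notation bounded_real X :=
  (@bounded_functional R (real_form S X) (@rnorm X)).

Lemma norm_rnorm (X : normedModType K) (x : X) : `|x| = of_real (rnorm x).
Proof. by rewrite (ge0_of_real S). Qed.

Lemma rnormD (X : normedModType K) (x y : real_form S X) :
  rnorm (x + y) <= rnorm x + rnorm y.
Proof. by rewrite -reD; apply: ler_re; exact: ler_normD. Qed.

Lemma rnormZ (X : normedModType K) a (x : real_form S X) :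
  rnorm (a *: x) = `|a| * rnorm x.
Proof. by rewrite /rnorm normrZ normr_of_real reZ. Qed.

Lemma rnormZ1 (X : normedModType K) (z : K) (x : X) : `|z| = 1 ->
  rnorm (z *: x) = rnorm x.
Proof. by move=> z1; rewrite /rnorm normrZ z1 mul1r. Qed.

Lemma unit_ballE (X : normedModType K) (x : X) : unit_ball X x <-> rnorm x <= 1.
Proof. by rewrite /unit_ball /= norm_rnorm -(rmorph1 of_real) ler_of_real. Qed.

Lemma bounded_opP (X Y : normedModType K) (T : X -> Y) :
  bounded_op T <-> exists M : R, forall x, rnorm (T x) <= M * rnorm x.
Proof.
split=> [[M TM]|[M TM]].
  exists (re M) => x; have /(ler_re S) := TM x.
  by rewrite [in leRHS]norm_rnorm mulrC reZ mulrC.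
by exists (of_real M) => x; rewrite !norm_rnorm -rmorphM ler_of_real.
Qed.

(** The real supremum, embedded in [K], is a least upper bound, so the choice made by [supremum] is
    one too. *)
Lemma opnorm_supremum (X Y : normedModType K) (T : X -> Y) : bounded_op T ->
  supremums [set `|T x| | x in unit_ball X] (opnorm T).
Proof.
move=> /bounded_opP[M TM].
pose E := [set rnorm (T x) | x in unit_ball X].
have Esup : has_sup E.
  split; first by exists (rnorm (T 0)); exists 0 => //; rewrite /unit_ball/= normr0.
  exists `|M| => _ [x /unit_ballE x1 <-]; apply: le_trans (TM x) _.
  have x0 : 0 <= rnorm x by rewrite -(ler_of_real S) rmorph0 -norm_rnorm.
  apply: (@le_trans _ _ (`|M| * rnorm x)); first by rewrite ler_wpM2r// ler_norm.
  by rewrite ler_piMr.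
have supE : supremums [set `|T x| | x in unit_ball X] (of_real (sup E)).
  split=> [_ [x x1 <-]|b bub].
    by rewrite norm_rnorm ler_of_real; apply: sup_upper_bound => //; exists x.
  (* A bound of norms is nonnegative, hence comes from a real number. *)
  have b0 : 0 <= b.
    apply: le_trans (normr_ge0 (T 0)) _; apply: bub; exists 0 => //.
    by rewrite /unit_ball/= normr0.
  rewrite -(ge0_of_real S b0) ler_of_real; apply: ge_sup; first by case: Esup.
  by move=> _ [x x1 <-]; apply: ler_re; apply: bub; exists x.
rewrite /opnorm /supremum; case: ifPn => [/eqP E0|_].
  have [[_ [x x1 _]] _] := Esup.
  by have : set0 (`|T x|) by rewrite -E0; exists x.
by apply: xgetPex; exists (of_real (sup E)).
Qed.

Lemma norm_le_opnorm (X Y : normedModType K) (T : X -> Y) x : bounded_op T ->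
  unit_ball X x -> `|T x| <= opnorm T.
Proof. by move=> /opnorm_supremum[ub _] x1; apply: ub; exists x. Qed.

Lemma opnorm_le (X Y : normedModType K) (T : X -> Y) (b : K) : bounded_op T ->
  (forall x, unit_ball X x -> `|T x| <= b) -> opnorm T <= b.
Proof.
by move=> /opnorm_supremum[_ lb] Tb; apply: lb => _ [x x1 <-]; exact: Tb.
Qed.

Lemma opnorm_ge0 (X Y : normedModType K) (T : X -> Y) : bounded_op T ->
  0 <= opnorm T.
Proof.
move=> Tb; apply: le_trans (normr_ge0 (T 0)) (norm_le_opnorm Tb _).
by rewrite /unit_ball/= normr0.
Qed.

(** * Real functionals as real parts of [K]-linear ones *)

Section Functionals.
Variable X : normedModType K.
Implicit Types (h : real_form S X -> R) (x : X) (z : K).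

Lemma dual_linear (f : dual X) : linear (f : X -> K^o).
Proof. by have := dual_funP f; rewrite inE => -[]. Qed.

Lemma dualZ (f : dual X) z x : f (z *: x) = z * f x.
Proof.
have f0 : f 0 = 0.
  by have := dual_linear f (-1) 0 0; rewrite scaler0 addr0 scaleN1r addNr.
by have := dual_linear f z x 0; rewrite f0 !addr0.
Qed.

Lemma dual_bounded (f : dual X) : bounded_op (f : X -> K^o).
Proof. by have := dual_funP f; rewrite inE => -[]. Qed.

Lemma real_part_functional (f : dual X) z :
  bounded_real X (fun x => re (z * f x)).
Proof.
split=> [a x y|].
  rewrite (_ : f (a *: x + y) = of_real a * f x + f y); last exact: dual_linear.
  by rewrite mulrDr mulrCA re_lin.
have /bounded_opP[M fM] := dual_bounded f.
exists (re `|z| * M) => x; apply: le_trans (re_le_norm _ _) _.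
rewrite normrM [in leLHS](norm_of_real S z) reZ -mulrA.
apply: ler_wpM2l (fM x).
by rewrite -(ler_of_real S) rmorph0 -norm_of_real.
Qed.

(** For fixed [x], [h (z *: x)] is real-linear in [z], so [re_repr] defines [f x]. The numbers
    [re (z * c)] determine [c], whence [f] is [K]-linear. *)
Lemma complexify h : bounded_real X h ->
  exists f : dual X, forall x z, re (z * f x) = h (z *: x).
Proof.
move=> [hl [M hM]].
have /choice[f fE] x : exists c, forall z, h (z *: x) = re (z * c).
  apply: (@re_repr _ _ S (fun z => h (z *: x))) => a z w; rewrite -hl; congr h.
  by rewrite scalerDl -scalerA.
have fl : linear (f : X -> K^o).
  move=> b x y; apply: (re_mul_inj (S := S)) => z.
  rewrite mulrDr mulrCA mulrA reD -!fE -(scalarfD _ _ hl); congr h.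
  by rewrite scalerDr scalerA mulrC.
have fb : bounded_op (f : X -> K^o).
  apply/bounded_opP; exists M => x; rewrite /rnorm.
  have [z z1 <-] := unimodular_mul (f x).
  by rewrite -fE (le_trans (hM _))// rnormZ1.
have fd : (f : X -> K^o) \in @dual_pred K X by rewrite inE.
by exists (Dual fd) => x z; rewrite -fE.
Qed.

Lemma complexify_norm h (f : dual X) :
  @dual_ball R (real_form S X) (@rnorm X) h ->
  (forall x z, re (z * f x) = h (z *: x)) -> opnorm f <= 1.
Proof.
move=> [hl hN] fE; apply: opnorm_le (dual_bounded f) _ => x x1.
have [z z1 zE] := unimodular_mul (f x).
rewrite (norm_of_real S) -zE fE -(rmorph1 of_real) ler_of_real.
by rewrite (le_trans (hN _))// rnormZ1//; exact/unit_ballE.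
Qed.

Lemma NA_eq_QNA_attain (Y : normedModType K) (y : Y) : y != 0 ->
  NA X Y = QNA X Y -> forall h, bounded_real X h ->
  exists2 x0, rnorm x0 <= 1 & forall x, rnorm x <= 1 -> h x <= h x0.
Proof.
move=> y0 NAQNA h hb; have [f fE] := complexify hb.
pose T0 x : Y := (f x : K) *: y.
have T0l : linear T0.
  move=> b u v; rewrite /T0 (_ : f (b *: u + v) = b * f u + f v).
    by rewrite scalerDl scalerA.
  exact: dual_linear.
pose T := HB.pack_for {linear X -> Y} T0 (GRing.isLinear.Build K X Y *:%R T0 T0l).
have Tb : bounded_op T.
  have [M fM] := dual_bounded f; exists (M * `|y|) => x.
  by rewrite /= /T0 normrZ mulrAC ler_wpM2r.
have y0' : 0 < `|y| by rewrite normr_gt0.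
(* This is the norm of [f], and [s *: y] is the vector that [T] quasi attains. *)
pose s := opnorm T / `|y|.
have sE : s * `|y| = opnorm T by rewrite /s divfK// gt_eqF.
have s0 : 0 <= s by rewrite divr_ge0// opnorm_ge0.
have fs x : unit_ball X x -> `|f x| <= s.
  move=> /(norm_le_opnorm Tb); rewrite /= /T0 normrZ -sE.
  by rewrite ler_pM2r.
have : QNA X Y T.
  split=> //; exists (s *: y); last by rewrite normrZ ger0_norm.
  move=> A /nbhs_ballP[e /= e0 eA].
  have [x x1 xs] : exists2 x, unit_ball X x & s - e / `|y| < `|f x|.
    apply: contrapT => nx.
    have : opnorm T <= (s - e / `|y|) * `|y|.
      apply: (opnorm_le Tb) => x x1; rewrite /= /T0 normrZ ler_pM2r//.
      have ey : e / `|y| = of_real (re (e / `|y|)).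
        by rewrite ge0_of_real// divr_ge0// ltW.
      rewrite -[s](ge0_of_real S)// ey -rmorphB (norm_of_real S (f x)) ler_of_real leNgt.
      apply/negP => lt_f; apply: nx; exists x => //.
      by rewrite -[s](ge0_of_real S)// ey -rmorphB (norm_of_real S (f x)) ltr_of_real.
    by rewrite mulrBl sE divfK ?gt_eqF// lerBrDl gerDr lt_geF.
  have [z z1 zE] := unimodular_mul (f x).
  (* Rotating [x] replaces [f x] by its modulus without leaving the ball. *)
  exists (`|f x| *: y); split.
    exists (z *: x); first by apply/unit_ballE; rewrite rnormZ1//; exact/unit_ballE.
    by rewrite /= /T0 dualZ zE.
  apply: eA; rewrite -ball_normE /= -scalerBl normrZ -ltr_pdivlMr//.
  rewrite ger0_norm ?subr_ge0 ?fs//; move: xs.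
  by rewrite ltrBlDr -ltrBlDl.
rewrite -NAQNA => -[_ [x0 x01 x0E]].
have fx0 : `|f x0| = s.
  by apply: (mulIf (lt0r_neq0 y0')); rewrite sE -x0E /= /T0 normrZ.
have [z z1 zE] := unimodular_mul (f x0).
exists (z *: x0); first by rewrite rnormZ1//; exact/unit_ballE.
move=> x /unit_ballE x1; rewrite -fE zE fx0.
have -> : h x = re (f x) by rewrite -[f x]mul1r fE scale1r.
by apply: le_trans (re_le_norm _ _) _; apply: ler_re; exact: fs.
Qed.

End Functionals.

Lemma rnorm_complete (X : completeNormedModType K) (u : nat -> real_form S X) :
  (forall e, 0 < e -> exists n0, forall m n, (n0 <= m)%N -> (n0 <= n)%N ->
    rnorm (u m - u n) <= e) ->
  exists x, forall e, 0 < e -> exists n0, forall n, (n0 <= n)%N ->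
    rnorm (u n - x) <= e.
Proof.
move=> uC.
have : cvg ((u : nat -> X) @ \oo).
  apply/cauchy_cvgP/cauchyP => e e0.
  have re0 : 0 < re e by rewrite -(ltr_of_real S) rmorph0 ge0_of_real// ltW.
  have [n0 n0P] := uC (re e / 2) (divr_gt0 re0 (ltr0Sn _ _)).
  exists (u n0 : X); exists n0 => // n /= nn; rewrite -ball_normE /=.
  have h := n0P n0 n (leqnn _) nn.
  rewrite norm_rnorm -(ge0_of_real S (ltW e0)) ltr_of_real.
  by apply: le_lt_trans h _; lra.
move=> /cvg_ex[x /cvgrPdist_lt ux]; exists x => e e0.
have ie0 : 0 < of_real e by rewrite -(rmorph0 of_real) ltr_of_real.
have [n0 _ n0P] := ux _ ie0; exists n0 => n /n0P /= /ltW.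
by rewrite distrC norm_rnorm ler_of_real.
Qed.

(** James' theorem is applied to [re (phi (F h))], where [F h] is the [K]-linear functional with
    real part [h]. *)
Theorem reflexive_of_attain (X : completeNormedModType K) :
  (forall h, bounded_real X h ->
    exists2 x0, rnorm x0 <= 1 & forall x, rnorm x <= 1 -> h x <= h x0) ->
  reflexive_space X.
Proof.
move=> attain phi [M phiM].
have d0 : bounded_real X (fun=> 0).
  exact: dual_ball_bounded (dual_ball0 (@rnormD X) (@rnormZ X)).
(* Functions that are not bounded functionals get an arbitrary element of the dual. *)
have /choice[F FE] : forall h : real_form S X -> R, exists f : dual X,
    bounded_real X h -> forall x z, re (z * f x) = h (z *: x).
  move=> h; have [hb|nh] := pselect (bounded_real X h).
    by have [f fE] := complexify hb; exists f.
  by have [f _] := complexify d0; exists f.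
have F_uniq h (f : dual X) : bounded_real X h ->
    (forall x z, re (z * f x) = h (z *: x)) -> F h = f.
  move=> hb fE; apply/val_inj/funext => x; apply: (re_mul_inj (S := S)) => z.
  by rewrite FE// fE.
have [a f g fb gb|f fb|x xP] := james (@rnormD X) (@rnormZ X)
  (Phi := fun h => re (phi (F h))) (M := `|re M|) (@rnorm_complete X) attain.
- rewrite (F_uniq _ (of_real a *: F f + F g)).
  + by rewrite linearP /= re_lin.
  + exact: (bounded_functional_lin (@rnormZ X) a fb gb).
  + move=> x z; rewrite -[(of_real a *: F f + F g) x]/(of_real a * F f x + F g x).
    by rewrite mulrDr mulrCA re_lin !FE.
- have fB := dual_ball_bounded fb.
  have o1 := complexify_norm fb (FE f fB).
  apply: le_trans (re_le_norm _ _) _.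
  have /(ler_re S) := phiM (F f); move=> /le_trans; apply.
  have o0 := opnorm_ge0 (dual_bounded (F f)).
  rewrite -(ge0_of_real S o0) mulrC reZ.
  have r0 : 0 <= re (opnorm (F f)) by rewrite -(ler_of_real S) rmorph0 ge0_of_real.
  have r1 : re (opnorm (F f)) <= 1 by rewrite -(re1 S); exact: ler_re.
  apply: le_trans (ler_wpM2l r0 (ler_norm _)) _.
  by rewrite ler_piMl.
exists x; apply/funext => f; apply: (re_mul_inj (S := S)) => z.
rewrite /canonical_embedding -(xP _ (real_part_functional f z)).
rewrite (F_uniq _ (z *: f)) ?linearZ//; first exact: real_part_functional.
by move=> y w; rewrite -[(z *: f) y]/(z * f y) dualZ mulrCA.
Qed.


Theorem NA_eq_QNA_of_reflexive (X Y : normedModType K) :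
  reflexive_space X -> NA X Y = QNA X Y.
Proof.
move=> refl; apply/seteqP; split=> T.
  move=> [Tb [x0 x01 Tx0]]; split=> //; exists (T x0) => //.
  by apply: subset_closure; exists x0.
move=> [Tb [u uT uE]]; split=> //.
(* These sets are nonempty because [u] is in the closure of the image of the ball; they generate the
   filter that [U] refines. *)
pose near_u (e : R) := [set x : X | unit_ball X x /\ rnorm (T x - u) < e].
have FF : ProperFilter (filter_from [set e : R | 0 < e] near_u).
  apply: filter_from_proper.
    apply: filter_from_filter; first by exists 1 => /=.
    move=> d e /= d0 e0; exists (Num.min d e); first by rewrite /= lt_min d0.
    by move=> x [x1]; rewrite lt_min => /andP[].
  move=> e /= e0; have ie0 : 0 < of_real e by rewrite -(rmorph0 of_real) ltr_of_real.
  have [_ [[x x1 <-]]] := uT _ (nbhsx_ballx u _ ie0).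
  rewrite -ball_normE /= distrC norm_rnorm ltr_of_real => xe.
  by exists x.
have [U [UU FU]] := ultraFilterLemma FF.
have PU := ultra_proper : ProperFilter U.
have UB : \forall x \near U, unit_ball X x.
  by apply: FU; exists 1 => //= x [].
have /choice[Psi PsiP] : forall f : dual X, exists c,
    forall z, re (z * f x) @[x --> U] --> re (z * c).
  move=> f; apply: (@scalar_ultralimit _ _ S _ U UU f (re (opnorm f))).
  move: UB; apply: filterS => x x1; apply: ler_re.
  exact: norm_le_opnorm (dual_bounded f) x1.
have Psi_lim (f : dual X) z : lim (re (z * f x) @[x --> U]) = re (z * Psi f).
  exact/cvg_lim.
have Psi_le (f : dual X) z c :
    (\forall x \near U, re (z * f x) <= c) -> re (z * Psi f) <= c.
  move=> fc; rewrite -Psi_lim; apply: limr_le => //.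
  by apply/cvg_ex; exists (re (z * Psi f)).
have Psi_linear : linear (Psi : dual X -> K^o).
  move=> b f g; apply: (re_mul_inj (S := S)) => z; rewrite -Psi_lim.
  apply/cvg_lim => //; rewrite mulrDr reD mulrA.
  rewrite (_ : (fun x => _) = (fun x => re (z * b * f x) + re (z * g x))).
    exact: cvgD.
  by apply/funext => x; rewrite -reD -mulrA -mulrDr.
pose phi := HB.pack_for {linear dual X -> K^o} (Psi : dual X -> K^o)
  (GRing.isLinear.Build K (dual X) K^o *:%R Psi Psi_linear).
have [|x xphi] := refl phi.
  exists 1 => f; rewrite mul1r /=.
  have [z z1 zE] := unimodular_mul (Psi f).
  have o0 := opnorm_ge0 (dual_bounded f).
  rewrite (norm_of_real S) -zE -(ge0_of_real S o0) ler_of_real.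
  apply: Psi_le; move: UB; apply: filterS => x x1.
  apply: le_trans (re_le_norm _ _) _; apply: ler_re.
  by rewrite normrM z1 mul1r; exact: norm_le_opnorm (dual_bounded f) x1.
have xE (f : dual X) : f x = Psi f.
  by rewrite -[LHS]/(canonical_embedding x f) xphi.
(* A norming functional of [x] is at most 1 on the ball, and its value at [x] is a limit of such
   values. *)
have x1 : rnorm x <= 1.
  have [h hb <-] := norming_functional (V := real_form S X)
    (@rnormD X) (@rnormZ X) x.
  have [f fE] := complexify (dual_ball_bounded hb).
  rewrite -[x in h x]scale1r -fE xE; apply: Psi_le.
  move: UB; apply: filterS => y /unit_ballE y1.
  by rewrite fE scale1r; have [_ hN] := hb; apply: le_trans (hN y) y1.
suff Tx : T x = u by exists x; [exact/unit_ballE|rewrite Tx].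
apply/eqP; rewrite -subr_eq0 -normr_eq0; apply/eqP; rewrite norm_rnorm.
(* Let [g] norm [T x - u]. Its composite with [T] extends to an element of the dual, so [g (T x)] is
   the limit of [g (T y)] along [U], which is [g u]. *)
have [g gb gE] := norming_functional (V := real_form S Y)
  (@rnormD Y) (@rnormZ Y) (T x - u).
have gl : scalar (g : real_form S Y -> R) by case: gb.
have gTb : bounded_real X (fun y => g (T y)).
  split=> [a y z|].
    rewrite -(gl a (T y) (T z)); congr g.
    exact: (linearP T (of_real a) y z).
  have /bounded_opP[M TM] := Tb; exists M => y.
  by have [_ gN] := gb; apply: le_trans (gN _) (TM y).
have [f fE] := complexify gTb.
suff : rnorm (T x - u) <= 0.
  move=> le0; rewrite (_ : rnorm _ = 0) ?rmorph0//.
  by apply/eqP; rewrite eq_le le0 -(ler_of_real S) rmorph0 -norm_rnorm /=.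
apply/ler_addgt0Pl => e e0; rewrite addr0 -gE.
rewrite (scalarfB (V := real_form S Y) _ _ gl) lerBlDr.
have -> : g (T x) = re (1 * f x) by rewrite fE scale1r.
rewrite xE; apply: Psi_le; apply: FU; exists e => //= y [_ ye].
rewrite fE scale1r -lerBlDr -(scalarfB (V := real_form S Y) _ _ gl).
by have [_ gN] := gb; apply: le_trans (gN _) (ltW ye).
Qed.

Theorem reflexive_tfae (X : completeNormedModType K) :
  [<-> reflexive_space X;
       forall Y : completeNormedModType K, NA X Y = QNA X Y;
       exists2 Y : completeNormedModType K,
         (exists y : Y, y != 0) & NA X Y = QNA X Y].
Proof.
split=> [refl Y|]; first exact: NA_eq_QNA_of_reflexive.
split=> [NAQNA|[Y [y y0] NAQNA]]; last first.
  by apply: reflexive_of_attain; exact: NA_eq_QNA_attain y0 NAQNA.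
exists (scalar_line S : completeNormedModType K); last exact: NAQNA.
by exists (1 : K); exact: oner_neq0.
Qed.

End Transfer.

Theorem proposition4p1 (R : realType) (K : numFieldType)
    (hK : K = R :> numFieldType \/ K = R[i] :> numFieldType)
    (X : completeNormedModType K) :
  [<-> reflexive_space X;
       forall Y : completeNormedModType K, NA X Y = QNA X Y;
       exists2 Y : completeNormedModType K,
         (exists y : Y, y != 0) & NA X Y = QNA X Y].
Proof.
case: hK => KE; subst K.
- exact: reflexive_tfae (real_scalars R) X.
- exact: reflexive_tfae (complex_scalars R) X.
Qed.
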